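(* Let $\xi,\xi_1,\xi_2,\dots$ be independent random variables with common distribution function $F$ and finite negative mean $\mathbf E\xi=-a<0$. Let $S_0=0$, $S_n=\xi_1+\cdots+\xi_n$ for $n\ge1$, and $M=\sup_{n\ge 0}S_n$. (i) If $F$ is long-tailed, then $$\liminf_{x\to\infty}\frac{\mathbf P(M>x)}{\overline F_s(x)}\ge\frac1a.$$ (ii) Assume in addition that $F\in\mathcal S^*$. Then $$\mathbf P(M>x)\sim\frac1a\,\overline F_s(x),\qquad x\to\infty.$$
   Context: Write $\overline F(x)=1-F(x)$ and $\overline F_s(x)=\int_x^\infty \overline F(u)\,du$. $F$ is called long-tailed if $\mathbf E e^{h\xi}=\infty$ for all $h>0$. A distribution function $F$ on $\mathbf R$ belongs to the class $\mathcal S^*$ (strong subexponential) if $$\int_0^x\overline F(x-y)\overline F(y)\,dy\sim 2a_+\overline F(x)\quad\text{as }x\to\infty,$$ where $a_+=\int_0^\infty\overline F(y)\,dy\in(0,\infty)$. Here $f(x)\sim g(x)$ as $x\to\infty$ means $f(x)/g(x)\to 1$ (in particular, for $F\in\mathcal S^*$, $\overline F(x)>0$ for all $x$). *)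

(* Defs.v *)
From HB Require Import structures.
From mathcomp Require Import all_boot all_order all_algebra finmap.
From mathcomp Require Import all_classical all_reals all_analysis.

Set Implicit Arguments.
Unset Strict Implicit.
Unset Printing Implicit Defensive.

Import Order.TTheory GRing.Theory Num.Theory.
Import numFieldNormedType.Exports.

Local Open Scope classical_set_scope.
Local Open Scope ring_scope.

Section distribution_functions.
Context {R : realType}.
Implicit Types (f g F : R -> R) (x : R).

Local Notation mu := (@lebesgue_measure R).

(** [f x / g x --> 1]; since [x / 0 = 0] here, this forces [g x != 0] for all
    large [x]. *)
Definition asymp_equiv f g : Prop := (f x / g x) @[x --> +oo] --> (1 : R).

Definition tail F x : R := 1 - F x.

Definition integrated_tail F x : R := \int[mu]_(u in `[x, +oo[) tail F u.

(** Kept extended-real so that its finiteness can be asserted. *)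
Definition tail_mass F : \bar R := (\int[mu]_(y in `[0%R, +oo[) (tail F y)%:E)%E.

Definition strong_subexponential F : Prop :=
  (0 < tail_mass F < +oo)%E /\
  asymp_equiv (fun x => \int[mu]_(y in `[0, x]) (tail F (x - y) * tail F y))
              (fun x => 2 * fine (tail_mass F) * tail F x).

End distribution_functions.

Section random_walks.
Context d (T : measurableType d) (R : realType) (P : probability T R).

(** The property of the law of [X] often called heavy-tailedness; it is not
    [tail F (x + y) ~ tail F x]. *)
Definition long_tailed (X : {RV P >-> R}) : Prop :=
  forall h : R, 0 < h -> mmt_gen_fun P X h = +oo%E.

Definition mutually_independent (X : nat -> {RV P >-> R}) : Prop :=
  forall (J : {fset nat}) (B : nat -> set R),
    (forall i, measurable (B i)) ->
    P (\bigcap_(i in [set` J]) (X i @^-1` B i)) =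
      (\prod_(i <- J) P (X i @^-1` B i))%E.

Definition partial_sum (X : nat -> {RV P >-> R}) (n : nat) (w : T) : R :=
  \sum_(1 <= i < n.+1) X i w.

Definition walk_sup (X : nat -> {RV P >-> R}) (w : T) : \bar R :=
  ereal_sup (range (fun n => (partial_sum X n w)%:E)).

Definition walk_sup_tail (X : nat -> {RV P >-> R}) (x : R) : R :=
  fine (P [set w | (x%:E < walk_sup X w)%E]).

End random_walks.

(* Main.v *)
Require Import Defs.
From HB Require Import structures.
From mathcomp Require Import all_boot all_order all_algebra finmap.
From mathcomp Require Import all_classical all_reals all_analysis.
From mathcomp Require Import measurable_realfun ring lra.

Set Implicit Arguments.
Unset Strict Implicit.
Unset Printing Implicit Defensive.

Import Order.TTheory GRing.Theory Num.Theory.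
Import numFieldNormedType.Exports.

Local Open Scope classical_set_scope.
Local Open Scope ring_scope.

(** Write [X] for an increment, [M] for the supremum of the walk, [h x] for
    [P(M > x)] and [Fs] for the integrated tail of [X]. The whole argument is
    about one function, the drift [Delta(x) = E (H(x) - H(x - X))], where [H] is
    a primitive of [h]; its derivative is [h(x) - E h(x - X)], and as [H] is
    almost linear far out, [Delta(x)] tends to [h(+oo) E X = - a h(+oo)].

    Conditioning on the first increment gives [h(x) >= E h(x - X)] for
    [x >= 0], so [Delta] is nondecreasing there and stays below its limit, which
    is at most 0: [Delta <= 0] ([walk_sup_drift_le0]). The tail [g_n] of the
    maximum of the first [n] partial sums satisfies instead
    [E g_n(x - X) = g_(n+1)(x) >= g_n(x)] and tends to 0 at infinity, so its
    drift is nonnegative ([walk_max_tail_submean]).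

    Lower bound. By monotonicity of [h] the increment [H(x) - H(x - X)] is at
    least [X h(x)]; if [X > x] it also covers a stretch of length [X - x] where
    [h] is 1. Taking expectations, [0 >= Delta(x) >= - a h(x) + (1 - h(x)) Fs(x)],
    that is [h >= Fs / (a + Fs)] ([walk_sup_tail_lower]), and [Fs] tends to 0.

    Upper bound. Let [h] now be any [g_n] and suppose [h <= K Fs] on [[0, x]].
    Truncating the jumps at a large level [D] turns [0 <= Delta(x)] into
      [a' h(x + D) <= b (h(x - D) - h(x + D)) + (1 + e K) Fs(x)],
    with [a'] close to [a] and [b = E |X|] ([submean_tail_step]). The jumps
    above [D] account for the last term: through [h <= K Fs] they produce
    [K] times the convolution of [Fs] and the tail over [[0, x - D]], and the
    convolution is at most [e Fs(x)], for large [x], because integrating the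
    definition of a strong subexponential law makes [Fs] subexponential
    ([integrated_tail_far_convolution]). The difference on the right need not be
    small at a given [x], but it telescopes: averaging over [J] points at
    distance [2D] from each other leaves only [b K / J], hence
    [h(x) <= ((1 + e) / a + e K) Fs(x)] for all large [x]
    ([submean_tail_averaged]). For [e = 1/2] this improves any admissible [K]
    above a fixed [B], so that [K = B] is admissible for all [n]
    ([submean_tail_bounded]); then [e] can be sent to 0 and [n] to infinity. *)

(** * Reflections of Lebesgue measure *)

Section lebesgue_reflection.
Context {R : realType}.
Local Notation mu := (@lebesgue_measure R).

Lemma measurable_reflect (c : R) :
  measurable_fun setT
    ((fun y => c - y) : measurableTypeR R -> measurableTypeR R).
Proof. exact: measurable_funD. Qed.

Lemma lebesgue_measure_reflect (c : R) (A : set R) : measurable A ->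
  pushforward mu
    ((fun y => c - y) : measurableTypeR R -> measurableTypeR R) A = mu A.
Proof.
move=> mA; apply/esym; apply: lebesgue_measure_unique => //.
  exact: measurable_reflect.
move=> mreflect _ [[a b]] _ <-.
rewrite /= /pushforward.
have -> : (fun y : R => c - y) @^-1` `]a, b] = `[c - b, c - a[%classic.
  by apply/seteqP; split => y /=; rewrite !in_itv/= => ?; lra.
rewrite !lebesgue_measure_itv/= !lte_fin.
have -> : (c - b < c - a) = (a < b) by apply/idP/idP; lra.
by case: ifP => // _; rewrite -!EFinD; congr EFin; lra.
Qed.

Lemma ge0_integral_reflect (c : R) (f : R -> \bar R) :
  measurable_fun setT f -> (forall y, (0 <= f y)%E) ->
  (\int[mu]_y f (c - y)%R = \int[mu]_y f y)%E.
Proof.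
move=> mf f0.
transitivity (\int[pushforward mu
    ((fun y => c - y)%R : measurableTypeR R -> measurableTypeR R)]_y f y)%E.
  by rewrite ge0_integral_pushforward//; exact: measurable_reflect.
apply: eq_measure_integral; first exact: measurable_reflect.
by move=> mreflect A mA _; exact: lebesgue_measure_reflect.
Qed.

Lemma ge0_integral_translate (c : R) (f : R -> \bar R) :
  measurable_fun setT f -> (forall y, (0 <= f y)%E) ->
  (\int[mu]_y f (y - c)%R = \int[mu]_y f y)%E.
Proof.
move=> mf f0; rewrite -[RHS](ge0_integral_reflect 0)//.
rewrite -[RHS](ge0_integral_reflect c)//; last first.
  exact: (measurableT_comp mf (measurable_reflect 0)).
by apply: eq_integral => y _; rewrite sub0r opprB.
Qed.

End lebesgue_reflection.

(** * Layer-cake formula *)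

Section layer_cake.
Context d (T : measurableType d) (R : realType) (P : probability T R).
Local Notation mu := (@lebesgue_measure R).
Local Open Scope ereal_scope.

Let below (X : {RV P >-> R}) (k : R -> R) : set (T * measurableTypeR R) :=
  [set wy | (k wy.2 < X wy.1)%R].

Let measurable_below (X : {RV P >-> R}) (k : R -> R) : measurable_fun setT k ->
  measurable (below X k).
Proof.
move=> mk; have mlt : measurable_fun setT
    (fun wy : T * measurableTypeR R => k wy.2 < X wy.1)%R.
  by apply: measurable_fun_ltr; exact: measurableT_comp.
rewrite (_ : below X k = setT `&`
    (fun wy => (k wy.2 < X wy.1)%R) @^-1` [set true]).
  exact: mlt.
by rewrite setTI.
Qed.

Let layer (X : {RV P >-> R}) (phi k : R -> R)
  (wy : T * measurableTypeR R) : \bar R := (phi wy.2 * \1_(below X k) wy)%:E.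

Let layerE (X : {RV P >-> R}) (phi k : R -> R) (w : T) (y : R) :
  layer X phi k (w, y) = (phi y * (k y < X w)%R%:R)%:E.
Proof.
rewrite /layer indicE/= (_ : ((w, y) \in _) = (k y < X w)%R)//.
by apply/idP/idP; rewrite in_setE.
Qed.

Let measurable_layer2 (X : {RV P >-> R}) (phi k : R -> R) :
  measurable_fun setT phi -> measurable_fun setT k ->
  measurable_fun setT (layer X phi k).
Proof.
move=> mphi mk; apply/measurable_EFinP/measurable_funM.
  exact: measurableT_comp.
by apply: measurable_indic; exact: measurable_below.
Qed.

Lemma measurable_layer (X : {RV P >-> R}) (phi k : R -> R) :
  measurable_fun setT phi -> (forall y, 0 <= phi y)%R -> measurable_fun setT k ->
  measurable_fun setT (fun w => \int[mu]_y (phi y * (k y < X w)%R%:R)%:E).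
Proof.
move=> mphi phi0 mk.
have -> : (fun w => \int[mu]_y (phi y * (k y < X w)%R%:R)%:E) =
    fubini_F mu (layer X phi k).
  by apply/funext => w; apply: eq_integral => y _; rewrite layerE.
apply: measurable_fun_fubini_tonelli_F; first exact: measurable_layer2.
by move=> wy; rewrite lee_fin mulr_ge0.
Qed.

(** Tonelli. The threshold [k y = y] turns integrated tails into expected
    excesses, and [k y = x - y] produces convolutions with the tail. *)
Lemma layer_cake (X : {RV P >-> R}) (phi k : R -> R) :
  measurable_fun setT phi -> (forall y, 0 <= phi y)%R -> measurable_fun setT k ->
  \int[P]_w \int[mu]_y (phi y * (k y < X w)%R%:R)%:E =
  \int[mu]_y ((phi y)%:E * ccdf X (k y)).
Proof.
move=> mphi phi0 mk.
have mem_preim w y : (w \in X @^-1` `]k y, +oo[) = (k y < X w)%R.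
  by apply/idP/idP; rewrite in_setE/= in_itv/= andbT.
transitivity (\int[P]_w \int[mu]_y layer X phi k (w, y)).
  by apply: eq_integral => w _; apply: eq_integral => y _; rewrite layerE.
rewrite fubini_tonelli//; last 2 first.
- exact: measurable_layer2.
- by move=> wy; rewrite lee_fin mulr_ge0.
apply: eq_integral => y _.
under eq_integral do rewrite layerE EFinM.
rewrite ge0_integralZl//; last 2 first.
- apply/measurable_EFinP; rewrite (_ : (fun w => _) = \1_(X @^-1` `]k y, +oo[)).
    apply: measurable_indic; exact: measurable_funPTI.
  by apply/funext => w; rewrite indicE mem_preim.
- by rewrite lee_fin.
congr (_ * _); transitivity (\int[P]_w (\1_(X @^-1` `]k y, +oo[) w)%:E).
  by apply: eq_integral => w _; rewrite indicE mem_preim.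
by rewrite integral_indic ?setIT//; exact: measurable_funPTI.
Qed.

End layer_cake.

(** * Primitives of monotone functions *)

Section monotone_primitive.
Context {R : realType}.
Local Notation mu := (@lebesgue_measure R).

(** A bound of the second order: over a partition of [[a, b]] into [n] equal
    steps the right-hand sides telescope to [(b - a) (h a - h b) / n]. This lets
    a function be compared with its formal derivative although [h] may jump. *)
Lemma increments_le_of_small (D h : R -> R) (a b : R) : a <= b ->
  (forall s t, a <= s -> s <= t -> t <= b ->
     D t - D s <= (t - s) * (h s - h t)) ->
  D b <= D a.
Proof.
move=> ab Dh.
have key (n : nat) : D b - D a <= (b - a) * (h a - h b) / n.+1%:R.
  pose p (i : nat) := a + (b - a) * i%:R / n.+1%:R.
  have p0 : p 0%N = a by rewrite /p mulr0 mul0r addr0.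
  have pn : p n.+1 = b by rewrite /p mulfK ?pnatr_eq0//; lra.
  have dp i : p i.+1 - p i = (b - a) / n.+1%:R.
    rewrite /p -[i.+1%:R]natr1.
    by move: (n.+1%:R) (pnatr_eq0 R n.+1) => N /negbT N0; field.
  have ba0 : 0 <= b - a by rewrite subr_ge0.
  have pS i : p i <= p i.+1 by rewrite -subr_ge0 dp divr_ge0.
  have ap i : a <= p i by rewrite /p lerDl divr_ge0// mulr_ge0.
  have pb i : (i <= n)%N -> p i.+1 <= b.
    move=> ilen; rewrite -[leRHS]pn /p lerD2l ler_wpM2r// ler_wpM2l//.
    by rewrite ler_nat.
  have -> : D b - D a = \sum_(0 <= i < n.+1) (D (p i.+1) - D (p i)).
    by rewrite (telescope_sumr (D \o p))//= p0 pn.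
  have -> : (b - a) * (h a - h b) / n.+1%:R =
      \sum_(0 <= i < n.+1) (b - a) / n.+1%:R * (h (p i) - h (p i.+1)).
    rewrite -big_distrr/= mulrAC; congr (_ * _).
    have := telescope_sumr (h \o p) (leq0n n.+1); rewrite /= p0 pn => hE.
    rewrite -[LHS]opprB -hE -sumrN; apply: eq_bigr => i _; rewrite opprB//.
  rewrite big_nat [leRHS]big_nat; apply: ler_sum => i /andP[_ ilt].
  by rewrite -[(b - a) / _](dp i); apply: Dh => //; exact: pb.
rewrite leNgt; apply/negP => Dab; rewrite -subr_gt0 in Dab.
have num0 : 0 <= (b - a) * (h a - h b) by have := key 0%N; rewrite divr1; lra.
have := archi_boundP (divr_ge0 num0 (ltW Dab)).
set n := Num.bound _ => nP; have := key n; rewrite ler_pdivlMr// => kn.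
move: nP; rewrite ltr_pdivrMr// => nP.
have : n%:R * (D b - D a) <= (D b - D a) * n.+1%:R; last lra.
by rewrite mulrC ler_pM2l// ler_nat.
Qed.

(** One of the two integrals is over an empty interval, so this is the primitive
    vanishing at 0, on the whole line. *)
Definition primitive (f : R -> R) (x : R) : R :=
  \int[mu]_(z in `]0, x]) f z - \int[mu]_(z in `]x, 0]) f z.

Variable h : R -> R.
Hypothesis h_nonincr : nonincreasing_fun h.
Hypothesis h01 : forall x, 0 <= h x <= 1.

Lemma integrable_monotone_itv (u v : R) : mu.-integrable `]u, v] (EFin \o h).
Proof.
apply: measurable_bounded_integrable => //.
- by rewrite /= lebesgue_measure_itv/=; case: ifP => // _; rewrite -EFinD ltry.
- exact: nonincreasing_measurable.
- exists 1; split; first exact: num_real.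
  move=> M M1 x _ /=; have /andP[h0 h1] := h01 x.
  by rewrite ger0_norm// (le_trans h1)// ltW.
Qed.

Lemma primitiveB (u v : R) : u <= v ->
  primitive h v - primitive h u = \int[mu]_(z in `]u, v]) h z.
Proof.
have cat (a b c : R) : a <= b -> b <= c ->
    \int[mu]_(z in `]a, c]) h z =
    \int[mu]_(z in `]a, b]) h z + \int[mu]_(z in `]b, c]) h z.
  move=> ab bc.
  have := @Rintegral_itvB _ h (BRight a) (BRight c) b (integrable_monotone_itv a c).
  rewrite !bnd_simp => /(_ ab bc) <-; lra.
have emp (a b : R) : b <= a -> \int[mu]_(z in `]a, b]) h z = 0.
  by move=> ba; rewrite set_itv_ge ?Rintegral_set0// bnd_simp -leNgt.
move=> uv; rewrite /primitive.
have [u0|u0] := leP 0 u.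
  rewrite (emp u 0)// (emp v 0) ?(le_trans u0)// (cat 0 u v)//; lra.
have [v0|v0] := leP 0 v.
  rewrite (emp v 0)// (emp 0 u) ?ltW// (cat u 0 v)//; [lra|exact: ltW].
rewrite (emp 0 u) ?(emp 0 v) ?ltW//.
by rewrite (cat u v 0)// ?ltW//; lra.
Qed.

Lemma primitiveB_bounds (u v : R) : u <= v ->
  (v - u) * h v <= primitive h v - primitive h u <= (v - u) * h u.
Proof.
move=> uv; rewrite primitiveB//.
have int_cst c : \int[mu]_(z in `]u, v]) c = (v - u) * c.
  rewrite Rintegral_cst//= lebesgue_measure_itv/= lte_fin.
  by move: uv; rewrite le_eqVlt => /predU1P[->|->]; rewrite ?ltxx/=; lra.
have icst c : mu.-integrable `]u, v] (EFin \o cst c).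
  apply: measurable_bounded_integrable => //.
    by rewrite /= lebesgue_measure_itv/=; case: ifP => // _; rewrite -EFinD ltry.
  exists `|c|; split; first exact: num_real.
  by move=> M cM x _ /=; exact: ltW.
rewrite -!int_cst; apply/andP; split; apply: le_Rintegral => //.
- exact: icst.
- exact: integrable_monotone_itv.
- by move=> z /=; rewrite in_itv/= => /andP[_ zv]; exact: h_nonincr.
- exact: integrable_monotone_itv.
- exact: icst.
- by move=> z /=; rewrite in_itv/= => /andP[uz _]; apply/h_nonincr/ltW.
Qed.

(** For [c < 0] the sign of [c] and the order of the two levels both change, so
    that one formula covers jumps in both directions. *)
Lemma primitive_increment (x c : R) :
  c * h x <= primitive h x - primitive h (x - c) <= c * h (x - c).
Proof.
have [c0|c0] := leP 0 c.
  have /primitiveB_bounds : x - c <= x by lra.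
  by rewrite (_ : x - (x - c) = c); [|lra].
have /primitiveB_bounds : x <= x - c by lra.
rewrite (_ : x - c - x = - c); last lra.
by rewrite !mulNr => /andP[? ?]; apply/andP; split; lra.
Qed.

Lemma primitive_nondecreasing : nondecreasing_fun (primitive h).
Proof.
move=> u v uv; rewrite -subr_ge0; have /andP[+ _] := primitiveB_bounds uv.
by apply: le_trans; rewrite mulr_ge0 ?subr_ge0//; have /andP[] := h01 v.
Qed.

Lemma primitive_lipschitz (x c : R) :
  `|primitive h x - primitive h (x - c)| <= `|c|.
Proof.
have /andP[] := primitive_increment x c.
have /andP[hx0 hx1] := h01 x; have /andP[hc0 hc1] := h01 (x - c).
have [c0|c0] := leP 0 c => lo up;
  [rewrite [X in _ <= X]ger0_norm//|rewrite [X in _ <= X]ltr0_norm//];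
  by rewrite ler_norml; apply/andP; split; nra.
Qed.

End monotone_primitive.

(** * The drift of a tail *)

Section drift.
Context d (T : measurableType d) (R : realType) (P : probability T R).
Variables (X : {RV P >-> R}) (h : R -> R).
Hypothesis X_int : P.-integrable [set: T] (EFin \o X).
Hypothesis h_nonincr : nonincreasing_fun h.
Hypothesis h01 : forall x, 0 <= h x <= 1.

(** Its derivative is [f x - E f (x - X)], formally: the drift measures how far
    [f] is from being harmonic for the walk, integrated in [x]. *)
Definition drift (f : R -> R) (x : R) : R :=
  \int[P]_w (primitive f x - primitive f (x - X w)).

Lemma integrable_affine_bound (c : R) (f : T -> R) : measurable_fun setT f ->
  (forall w, `|f w| <= c + `|X w|) -> P.-integrable [set: T] (EFin \o f).
Proof.
move=> mf fX; apply: (@le_integrable _ _ _ P setT measurableT _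
  (fun w => (c%:E + `|X w|%:E)%E)).
- exact/measurable_EFinP.
- move=> w _ /=; rewrite lee_fin; apply: le_trans (fX w) _.
  exact: ler_norm.
- apply: integrableD => //.
    exact: (finite_measure_integrable_cst P c measurableT).
  exact: (integrable_norm X_int).
Qed.

Lemma integrable_bounded (c : R) (f : T -> R) : measurable_fun setT f ->
  (forall w, `|f w| <= c) -> P.-integrable [set: T] (EFin \o f).
Proof.
move=> mf fc; apply: (integrable_affine_bound (c := c)) => // w.
by rewrite (le_trans (fc w))// lerDl.
Qed.

Lemma measurable_comp_reflect (f : R -> R) (x : R) : measurable_fun setT f ->
  measurable_fun setT (fun w => f (x - X w)).
Proof. by move=> mf; apply: measurableT_comp => //; exact: measurable_funB. Qed.

Lemma measurable_primitive : measurable_fun setT (primitive h).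
Proof.
by apply: nondecreasing_measurable => //; exact: primitive_nondecreasing.
Qed.

Lemma integrable_drift (x : R) :
  P.-integrable [set: T]
    (EFin \o (fun w => primitive h x - primitive h (x - X w))).
Proof.
apply: (integrable_affine_bound (c := 0)) => [|w].
  apply: measurable_funB => //.
  exact: measurable_comp_reflect measurable_primitive.
by rewrite add0r primitive_lipschitz.
Qed.

Lemma integrable_tail_reflect (x : R) :
  P.-integrable [set: T] (EFin \o (fun w => h (x - X w))).
Proof.
apply: (integrable_bounded (c := 1)) => [|w].
  by apply: measurable_comp_reflect; exact: nonincreasing_measurable.
by have /andP[? ?] := h01 (x - X w); rewrite ger0_norm.
Qed.

Lemma Rintegral_probability_cst (c : R) : \int[P]_w c = c.
Proof.
rewrite Rintegral_cst// -[RHS]mulr1; congr (_ * _).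
exact: (congr1 fine (probability_setT P)).
Qed.

(** Each side is [t - s] times the derivative of the drift with its two terms
    evaluated at opposite ends of [[s, t]], as [h] is monotone. *)
Lemma driftB_bounds (s t : R) : s <= t ->
  (t - s) * (h t - \int[P]_w h (s - X w)) <= drift h t - drift h s
    <= (t - s) * (h s - \int[P]_w h (t - X w)).
Proof.
move=> st.
have iB : P.-integrable [set: T]
    (EFin \o (fun w => primitive h (t - X w) - primitive h (s - X w))).
  apply: (integrable_bounded (c := t - s)) => [|w].
    by apply: measurable_funB;
      exact: measurable_comp_reflect measurable_primitive.
  have := primitive_lipschitz h_nonincr h01 (t - X w) (t - s).
  rewrite (_ : t - X w - (t - s) = s - X w); last lra.
  by rewrite [X in _ <= X]ger0_norm ?subr_ge0.
have B_bounds w : (t - s) * h (t - X w) <=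
    primitive h (t - X w) - primitive h (s - X w) <= (t - s) * h (s - X w).
  move: (X w) => x; have /(primitiveB_bounds h_nonincr h01) : s - x <= t - x by lra.
  by rewrite (_ : t - x - (s - x) = t - s)//; lra.
have dE : drift h t - drift h s = (primitive h t - primitive h s) -
    \int[P]_w (primitive h (t - X w) - primitive h (s - X w)).
  transitivity (\int[P]_w (primitive h t - primitive h s -
      (primitive h (t - X w) - primitive h (s - X w)))).
    have := RintegralB measurableT (integrable_drift t) (integrable_drift s).
    by move=> /esym/= ->; apply: eq_Rintegral => w _; lra.
  have := RintegralB measurableT (finite_measure_integrable_cst P
    (primitive h t - primitive h s) measurableT) iB.
  by rewrite /= Rintegral_probability_cst.
have imul x : P.-integrable [set: T] (EFin \o (fun w => (t - s) * h (x - X w))).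
  exact: (integrableZl measurableT (t - s) (integrable_tail_reflect x)).
have lo : (t - s) * \int[P]_w h (t - X w) <=
    \int[P]_w (primitive h (t - X w) - primitive h (s - X w)).
  rewrite -(RintegralZl (t - s) measurableT (integrable_tail_reflect t)).
  apply: (le_Rintegral measurableT (imul t) iB) => w _.
  by have /andP[] := B_bounds w.
have up : \int[P]_w (primitive h (t - X w) - primitive h (s - X w)) <=
    (t - s) * \int[P]_w h (s - X w).
  rewrite -(RintegralZl (t - s) measurableT (integrable_tail_reflect s)).
  apply: (le_Rintegral measurableT iB (imul s)) => w _.
  by have /andP[] := B_bounds w.
have /andP[Hlo Hup] := primitiveB_bounds h_nonincr h01 st.
by rewrite dE !mulrBr (lerB Hlo up) (lerB Hup lo).
Qed.

(** The sum of the errors [(t - s) * (h s - h t)] vanishes under refinement. *)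
Lemma drift_nonincreasing (x y : R) : 0 <= x -> x <= y ->
  (forall z, 0 <= z -> h z <= \int[P]_w h (z - X w)) ->
  drift h y <= drift h x.
Proof.
move=> x0 xy sub; apply: (increments_le_of_small (h := h)) => // s t xs st _.
have /andP[_ /le_trans] := driftB_bounds st; apply.
by rewrite ler_wpM2l ?subr_ge0// lerB// sub//; lra.
Qed.

Lemma drift_nondecreasing (x y : R) : 0 <= x -> x <= y ->
  (forall z, 0 <= z -> \int[P]_w h (z - X w) <= h z) ->
  drift h x <= drift h y.
Proof.
move=> x0 xy sup; rewrite -lerN2.
apply: (increments_le_of_small (D := \- drift h) (h := h)) => // s t xs st _.
have lo : (t - s) * (h t - h s) <= drift h t - drift h s.
  have /andP[+ _] := driftB_bounds st; apply: le_trans.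
  by rewrite ler_wpM2l ?subr_ge0// lerB// sup// (le_trans x0).
move: lo => /=; move: (drift h t) (drift h s) => u v; nra.
Qed.

(** Far out the primitive of [h] is almost linear with slope [p], so that a jump
    [X] changes it by about [p * X]; the change is dominated by [|X|]. *)
Lemma cvg_drift (p : R) : h x @[x --> +oo] --> p ->
  drift h n%:R @[n --> \oo] --> p * \int[P]_w X w.
Proof.
move=> hp.
have hpn c : h (n%:R - c) @[n --> \oo] --> p.
  apply: (@cvg_comp _ _ _ (fun n : nat => n%:R - c : R) h) hp.
  apply/cvgryPge => A; near=> n; rewrite lerBrDr.
  by near: n; exact: nbhs_infty_ger.
pose f n w := (primitive h n%:R - primitive h (n%:R - X w))%:E.
have f_cvg w : f ^~ w @ \oo --> (p * X w)%:E.
  apply: cvg_EFin; first exact: nearW.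
  apply: (@squeeze_cvgr _ _ _ _ (fun n => X w * h n%:R)
    (fun n => X w * h (n%:R - X w))).
  - by apply: nearW => n; exact: primitive_increment.
  - by rewrite mulrC; apply: cvgMr; have := hpn 0; under eq_fun do rewrite subr0.
  - by rewrite mulrC; apply: cvgMr.
have [] := @dominated_convergence _ _ _ P setT measurableT f
  (fun w => (p * X w)%:E) (fun w => `|X w|%:E).
- by move=> n; exact: measurable_int (integrable_drift n%:R).
- by apply/measurable_EFinP; exact: measurable_funM.
- by apply: nearW => w _; exact: f_cvg.
- exact: (integrable_norm X_int).
- by apply: nearW => w n _; rewrite lee_fin primitive_lipschitz.
move=> _ _ lim; rewrite -(RintegralZl p measurableT X_int); apply: fine_cvg.
rewrite fineK//; apply: integrable_fin_num => //.
exact: (integrableZl measurableT p X_int).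
Unshelve. all: by end_near. Qed.

End drift.

(** * Integrated tails as expected excesses *)

Section integrated_tails.
Context d (T : measurableType d) (R : realType) (P : probability T R).
Variables (X : {RV P >-> R}) (F : R -> R).
Hypothesis X_cdf : forall x, cdf X x = (F x)%:E.
Hypothesis X_int : P.-integrable [set: T] (EFin \o X).
Local Notation mu := (@lebesgue_measure R).
Local Notation Fs := (integrated_tail F).

Lemma ccdf_tail (x : R) : ccdf X x = (tail F x)%:E.
Proof. by rewrite ccdf_1_cdf X_cdf. Qed.

Lemma tail_ge0 (x : R) : 0 <= tail F x.
Proof. by rewrite -lee_fin -ccdf_tail. Qed.

Lemma tail_le1 (x : R) : tail F x <= 1.
Proof. by rewrite -lee_fin -ccdf_tail probability_le1. Qed.

Lemma tail_nonincreasing : nonincreasing_fun (tail F).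
Proof. by move=> x y xy; rewrite -lee_fin -!ccdf_tail ccdf_nonincreasing. Qed.

Lemma measurable_tail : measurable_fun setT (tail F).
Proof. by apply: nonincreasing_measurable => //; exact: tail_nonincreasing. Qed.

Definition excess (x : R) (w : T) : R := Num.max (X w - x) 0.

Lemma measurable_excess (x : R) : measurable_fun setT (excess x).
Proof. by apply: measurable_maxr => //; exact: measurable_funB. Qed.

Lemma excess_ge0 (x : R) (w : T) : 0 <= excess x w.
Proof. by rewrite le_max lexx orbT. Qed.

Lemma excess_le (x : R) (w : T) : excess x w <= `|x| + `|X w|.
Proof.
rewrite /excess ge_max; apply/andP; split; last exact: addr_ge0.
by rewrite addrC lerD// ?ler_norm// -normrN ler_norm.
Qed.

Lemma integrable_excess (x : R) : P.-integrable [set: T] (EFin \o excess x).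
Proof.
apply: (integrable_affine_bound X_int (c := `|x|)) => [|w].
  exact: measurable_excess.
by rewrite ger0_norm ?excess_ge0// excess_le.
Qed.

(** The excess [max(X - x, 0)] is the length of the interval from [x] to [X]. *)
Lemma integral_excess (x : R) :
  (\int[P]_w (excess x w)%:E = \int[mu]_(u in `[x, +oo[) (tail F u)%:E)%E.
Proof.
transitivity (\int[P]_w \int[mu]_y
    (\1_(`[x, +oo[%classic : set R) y * (y < X w)%R%:R)%:E)%E; last first.
  rewrite (layer_cake X (k := id))//.
  rewrite [RHS]integral_mkcond; apply: eq_integral => y _.
  by rewrite patchE indicE ccdf_tail; case: ifPn => _; rewrite ?mul1e ?mul0e.
apply: eq_integral => w _.
transitivity (\int[mu]_y (\1_(`[x, X w[%classic : set R) y)%:E)%E.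
  rewrite integral_indic// setIT /= lebesgue_measure_itv/= lte_fin /excess.
  case: ifPn => [xX|]; last by rewrite -leNgt => Xx; rewrite max_r// subr_le0.
  by rewrite -EFinB max_l// subr_ge0 ltW.
apply: eq_integral => y _; rewrite !indicE -natrM mulnb; congr (_%:R)%:E.
congr nat_of_bool.
by apply/idP/andP; rewrite !in_setE/= !in_itv/= andbT => /andP.
Qed.

Lemma integrated_tailE (x : R) : Fs x = \int[P]_w excess x w.
Proof. by rewrite /integrated_tail /Rintegral -integral_excess. Qed.

Lemma EFin_integrated_tail (x : R) :
  ((Fs x)%:E = \int[mu]_(u in `[x, +oo[) (tail F u)%:E)%E.
Proof.
rewrite -integral_excess integrated_tailE /Rintegral fineK//.
exact: (integrable_fin_num measurableT (integrable_excess x)).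
Qed.

Lemma integrated_tail_ge0 (x : R) : 0 <= Fs x.
Proof.
by rewrite integrated_tailE; apply: Rintegral_ge0 => w _; exact: excess_ge0.
Qed.

Lemma integrated_tail_nonincreasing : nonincreasing_fun Fs.
Proof.
move=> x y xy; rewrite !integrated_tailE.
apply: (le_Rintegral measurableT (integrable_excess y) (integrable_excess x)).
move=> w _; rewrite /excess ge_max !le_max lexx orbT andbT.
by rewrite lerB.
Qed.

Lemma measurable_integrated_tail : measurable_fun setT Fs.
Proof.
by apply: nonincreasing_measurable => //; exact: integrated_tail_nonincreasing.
Qed.

Lemma integrated_tail_gt0 : (forall x, 0 < tail F x) -> forall x, 0 < Fs x.
Proof.
move=> tail0 x; rewrite -lte_fin EFin_integrated_tail.
apply: (@lt_le_trans _ _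
  (\int[mu]_(u in `[x, (x + 1)%R]) (tail F (x + 1)%R)%:E)%E).
  rewrite integral_cst//= lebesgue_measure_itv/= lte_fin ltrDl ltr01.
  by rewrite -EFinB -EFinM lte_fin (_ : x + 1 - x = 1) ?mulr1//; lra.
apply: (@le_trans _ _ (\int[mu]_(u in `[x, (x + 1)%R]) (tail F u)%:E)%E).
  apply: ge0_le_integral => //.
  - by move=> u _; rewrite lee_fin tail_ge0.
  - by apply/measurable_EFinP; apply: measurable_funTS; exact: measurable_tail.
  - move=> u /=; rewrite in_itv/= lee_fin => /andP[_ ux].
    exact: tail_nonincreasing.
apply: ge0_subset_integral => //.
- by apply/measurable_EFinP; apply: measurable_funTS; exact: measurable_tail.
- by move=> u _; rewrite lee_fin tail_ge0.
- by move=> u /=; rewrite !in_itv/= => /andP[->].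
Qed.

Lemma cvg_Rintegral_excess (Y : {RV P >-> R}) :
  P.-integrable [set: T] (EFin \o Y) ->
  \int[P]_w Num.max (Y w - n%:R) 0 @[n --> \oo] --> (0 : R).
Proof.
move=> Y_int.
have [] := @dominated_convergence _ _ _ P setT measurableT
  (fun n w => (Num.max (Y w - n%:R) 0)%:E) (fun=> 0%E) (fun w => `|Y w|%:E).
- move=> n; apply/measurable_EFinP.
  by apply: measurable_maxr => //; exact: measurable_funB.
- exact: measurable_cst.
- apply: nearW => w _; apply: cvg_near_cst.
  near=> n; congr EFin; rewrite max_r// subr_le0.
  by near: n; exact: nbhs_infty_ger.
- exact: (integrable_norm Y_int).
- apply: nearW => w n _; rewrite lee_fin ger0_norm ?le_max ?lexx ?orbT//.
  by rewrite ge_max normr_ge0 andbT lerBlDr ler_wpDr// ler_norm.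
move=> _ _; rewrite integral0 => lim.
exact: fine_cvg lim.
Unshelve. all: by end_near. Qed.

Lemma integrated_tail_cvg0 : Fs x @[x --> +oo] --> (0 : R).
Proof.
apply/cvgrPdist_le => e e0.
have /cvgrPdist_le/(_ e e0)[N _ /(_ N (leqnn N))] := cvg_Rintegral_excess X_int.
rewrite /= sub0r normrN -integrated_tailE ger0_norm ?integrated_tail_ge0// => FN.
near=> x; rewrite sub0r normrN ger0_norm ?integrated_tail_ge0//.
apply: le_trans FN; apply: integrated_tail_nonincreasing.
by near: x; exact: nbhs_pinfty_ge.
Unshelve. all: by end_near. Qed.

End integrated_tails.

(** * Effect of a single jump on the primitive *)

Section drift_bounds.
Context d (T : measurableType d) (R : realType) (P : probability T R).
Variables (X : {RV P >-> R}) (F : R -> R).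
Hypothesis X_cdf : forall x, cdf X x = (F x)%:E.
Hypothesis X_int : P.-integrable [set: T] (EFin \o X).
Local Notation mu := (@lebesgue_measure R).
Local Notation Fs := (integrated_tail F).
Variable h : R -> R.
Hypothesis h_nonincr : nonincreasing_fun h.
Hypothesis h01 : forall x, 0 <= h x <= 1.
Hypothesis h_neg : forall x : R, x < 0 -> h x = 1.

Let h_ge0 x : 0 <= h x. Proof. by have /andP[] := h01 x. Qed.
Let h_le1 x : h x <= 1. Proof. by have /andP[] := h01 x. Qed.

(** The lower bound of [primitiveB_bounds] on [[y, 0]] would only give [h 0],
    which may be less than 1; it is used on [[y, -e]] instead. *)
Lemma primitive_neg (y : R) : y <= 0 -> primitive h 0 - primitive h y = - y.
Proof.
move=> y0; have /andP[_ up] := primitiveB_bounds h_nonincr h01 y0.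
apply/eqP; rewrite eq_le; apply/andP; split.
  by rewrite (le_trans up)// sub0r ler_piMr// oppr_ge0.
apply/ler_addgt0Pr => e e0.
have [ey|ye] := leP (- e) y.
  have /andP[lo _] := primitiveB_bounds h_nonincr h01 y0.
  have : 0 <= (0 - y) * h 0 by rewrite mulr_ge0// sub0r oppr_ge0.
  move: lo; move: (primitive h 0) (primitive h y) => u v; lra.
have /(primitiveB_bounds h_nonincr h01)/andP[lo _] : y <= - e by exact: ltW.
have /(primitiveB_bounds h_nonincr h01)/andP[lo' _] : - e <= 0 by lra.
have : 0 <= (0 - - e) * h 0 by rewrite mulr_ge0//; lra.
move: lo lo'; rewrite (h_neg (x := - e)); last by lra.
move: (primitive h 0) (primitive h y) (primitive h (- e)) => u v w; lra.
Qed.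

(** When [c > x], the levels from [x - c] to 0 form a stretch of length [c - x]
    where [h] is 1, and not just at least [h x]. *)
Lemma primitive_increment_lower (x c : R) : 0 <= x ->
  c * h x + Num.max (c - x) 0 * (1 - h x) <= primitive h x - primitive h (x - c).
Proof.
move=> x0; have [cx|xc] := leP c x.
  have /andP[+ _] := primitive_increment h_nonincr h01 x c.
  by rewrite max_r ?subr_le0// mul0r addr0.
rewrite max_l ?subr_ge0 ?(ltW xc)//.
have /primitive_neg : x - c <= 0 by lra.
have /andP[+ _] := primitiveB_bounds h_nonincr h01 x0.
move: (primitive h x) (primitive h (x - c)) (primitive h 0) => u v w; lra.
Qed.

Lemma drift_lower_bound (x : R) : 0 <= x ->
  \int[P]_w X w * h x + Fs x * (1 - h x) <= drift X h x.
Proof.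
move=> x0; rewrite (integrated_tailE X_cdf).
rewrite mulrC [X in _ + X]mulrC.
rewrite -(RintegralZl _ measurableT X_int).
rewrite -(RintegralZl _ measurableT (integrable_excess X_int x)).
have i1 := integrableZl measurableT (h x) X_int.
have i2 := integrableZl measurableT (1 - h x) (integrable_excess X_int x).
rewrite -(RintegralD measurableT i1 i2).
apply: (le_Rintegral measurableT (integrableD measurableT i1 i2)
  (integrable_drift X_int h_nonincr h01 x)) => w _ /=.
by rewrite mulrC [X in _ + X]mulrC; exact: primitive_increment_lower.
Qed.

(** Truncation of a jump to [[- D, D]]. *)
Definition clip (D c : R) : R := Num.max (Num.min c D) (- D).

(** Moderate jumps are all charged the value [h (x + D)]. The error is controlled
    by the variation of [h] over [[x - D, x + D]], in the second term; the third
    term is what a jump above [D] adds below level [x - D]. *)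
Lemma primitive_increment_upper (x D c : R) : 0 <= D ->
  primitive h x - primitive h (x - c) <=
  clip D c * h (x + D) + `|c| * (h (x - D) - h (x + D)) +
  (primitive h (x - D) - primitive h (x - Num.max c D)).
Proof.
move=> D0.
have hD : 0 <= h (x - D) - h (x + D) by rewrite subr_ge0 h_nonincr//; lra.
have cD : 0 <= `|c| * (h (x - D) - h (x + D)) by exact: mulr_ge0.
have [Dc|cD'] := leP D c.
  rewrite /clip min_r// max_l//; last lra.
  have /andP[_] := primitive_increment h_nonincr h01 x D.
  have : D * (h (x - D) - h (x + D)) <= `|c| * (h (x - D) - h (x + D)).
    by rewrite ler_wpM2r// (le_trans Dc)// ler_norm.
  move: (primitive h x) (primitive h (x - D)) (primitive h (x - c)) => u v w.
  lra.
rewrite subrr addr0 /clip min_l ?(ltW cD')//.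
have /andP[_ up] := primitive_increment h_nonincr h01 x c.
have [c0|c0] := leP 0 c.
  rewrite max_l; last lra.
  have hc : c * h (x - c) <= c * h (x - D) by rewrite ler_wpM2l// h_nonincr//; lra.
  move: up cD; rewrite (ger0_norm c0).
  move: (primitive h x) (primitive h (x - c)) => u v; lra.
have [cND|NDc] := leP c (- D).
  have /(primitiveB_bounds h_nonincr h01)/andP[lo _] : x <= x + D by lra.
  have /(primitive_nondecreasing h_nonincr h01) : x + D <= x - c by lra.
  move: lo; rewrite (_ : x + D - x = D); last lra.
  move: (primitive h x) (primitive h (x - c)) (primitive h (x + D)) => u v w; lra.
have hc : c * h (x - c) <= c * h (x + D).
  by rewrite ler_wnM2l ?(ltW c0)// h_nonincr//; lra.
move: up; move: (primitive h x) (primitive h (x - c)) => u v; lra.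
Qed.

Lemma measurable_threshold (x c : R) :
  measurable_fun setT (fun z : R => (x - z < c)%R%:R : R).
Proof.
rewrite (_ : (fun z => _) = \1_(`]x - c, +oo[%classic : set R)).
  exact: measurable_indic.
apply/funext => z; rewrite indicE; congr (nat_of_bool _)%:R.
by apply/idP/idP; rewrite in_setE/= in_itv/= andbT; lra.
Qed.

(** Above level 0 the bound [h <= K * Fs] is used; the stretch below level 0 has
    length at most [max(c - x, 0)] and [h <= 1] there. *)
Lemma primitive_far_increment (x D K c : R) : 0 <= D -> D <= x -> 0 <= K ->
  (forall y, 0 <= y -> y <= x -> h y <= K * Fs y) ->
  ((primitive h (x - D) - primitive h (x - Num.max c D))%:E <=
   K%:E * (\int[mu]_z (Fs z * \1_(`[0, x - D]%classic : set R) z *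
                        (x - z < c)%R%:R)%:E)
   + (Num.max (c - x) 0)%:E)%E.
Proof.
move=> D0 Dx K0 hK.
set I := (\int[mu]_z _)%E.
have Fs0 := integrated_tail_ge0 X_cdf.
have I0 : (0 <= I)%E.
  by apply: integral_ge0 => z _; rewrite lee_fin !mulr_ge0.
have mx0 : 0 <= Num.max (c - x) 0 by rewrite le_max lexx orbT.
have [cD|Dc] := leP c D.
  by rewrite subrr adde_ge0// mule_ge0// lee_fin.
pose g z := Fs z * \1_(`[0, x - D]%classic : set R) z * (x - z < c)%R%:R.
have g0 z : 0 <= g z by rewrite !mulr_ge0.
have mg : measurable_fun setT g.
  apply: measurable_funM; last exact: measurable_threshold.
  apply: measurable_funM; last exact: measurable_indic.
  exact: (measurable_integrated_tail X_cdf).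
have mKg : measurable_fun setT (fun z => (K * g z)%:E).
  by apply/measurable_EFinP; exact: measurable_funM.
(* the part of the jump that stays above level 0 *)
have above (u : R) : 0 <= u -> x - c <= u -> u <= x - D ->
    ((primitive h (x - D) - primitive h u)%:E <= K%:E * I)%E.
  move=> u0 cu ux; rewrite primitiveB// /Rintegral fineK; last first.
    apply: integrable_fin_num => //; exact: integrable_monotone_itv.
  apply: (@le_trans _ _ (\int[mu]_(z in `]u, (x - D)%R]) (K * g z)%:E)%E).
    apply: ge0_le_integral => //.
    - by move=> z _; rewrite lee_fin.
    - by apply/measurable_EFinP; exact: nonincreasing_measurable.
    - exact: measurable_funTS.
    - move=> z /=; rewrite in_itv/= lee_fin => /andP[uz zx].
      rewrite /g indicE mem_set/=; last by rewrite in_itv/= zx andbT; lra.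
      have -> : (x - z < c) by lra.
      by rewrite !mulr1; apply: hK; lra.
  apply: (@le_trans _ _ (\int[mu]_z (K * g z)%:E)%E).
    apply: ge0_subset_integral => //.
    by move=> z _; rewrite lee_fin mulr_ge0.
  under eq_integral do rewrite EFinM.
  rewrite ge0_integralZl_EFin//; last exact/measurable_EFinP.
  by move=> z _; rewrite lee_fin.
have [cx|xc] := leP c x.
  apply: le_trans (above (x - c) _ _ _) _; [lra|lra|lra|].
  by rewrite leeDl// lee_fin.
have -> : primitive h (x - D) - primitive h (x - c) =
   (primitive h (x - D) - primitive h 0) + Num.max (c - x) 0.
  rewrite max_l ?subr_ge0 ?(ltW xc)//.
  have /primitive_neg : x - c <= 0 by lra.
  by move: (primitive h (x - D)) (primitive h (x - c)) (primitive h 0) => p q r; lra.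
by rewrite EFinD leeD2r//; apply: above => //; lra.
Qed.

Lemma integrable_far_increment (x D : R) : P.-integrable [set: T]
  (EFin \o (fun w => primitive h (x - D) - primitive h (x - Num.max (X w) D))).
Proof.
apply: (integrable_affine_bound X_int (c := `|D|)) => [|w].
  apply: measurable_funB => //.
  apply: (measurableT_comp (measurable_primitive h_nonincr h01)).
  by apply: measurable_funB => //; exact: measurable_maxr.
have := primitive_lipschitz h_nonincr h01 (x - D) (Num.max (X w) D - D).
rewrite (_ : x - D - _ = x - Num.max (X w) D); last lra.
move=> /le_trans; apply; rewrite ger0_norm; last first.
  by rewrite subr_ge0 le_max lexx orbT.
have [XD|DX] := leP (X w) D; first by rewrite subrr addr_ge0.
by rewrite addrC lerD// ?ler_norm// -normrN ler_norm.
Qed.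

(** A level [z] is crossed by a jump from [x] with probability [tail F (x - z)],
    and the expected stretch below level 0 is [Fs x]. *)
Lemma integral_far_increment (x D K : R) : 0 <= D -> D <= x -> 0 <= K ->
  (forall y, 0 <= y -> y <= x -> h y <= K * Fs y) ->
  ((\int[P]_w (primitive h (x - D) - primitive h (x - Num.max (X w) D)))%:E <=
   K%:E * \int[mu]_(z in `[0%R, (x - D)%R]) (Fs z * tail F (x - z)%R)%:E
   + (Fs x)%:E)%E.
Proof.
move=> D0 Dx K0 hK.
have Fs0 := integrated_tail_ge0 X_cdf.
pose phi z := Fs z * \1_(`[0, x - D]%classic : set R) z.
have phi0 z : 0 <= phi z by rewrite mulr_ge0.
have mphi : measurable_fun setT phi.
  apply: measurable_funM; last exact: measurable_indic.
  exact: (measurable_integrated_tail X_cdf).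
have I_ge0 w : (0 <= \int[mu]_z (phi z * (x - z < X w)%R%:R)%:E)%E.
  by apply: integral_ge0 => z _; rewrite lee_fin mulr_ge0.
have mI : measurable_fun setT
    (fun w => \int[mu]_z (phi z * (x - z < X w)%R%:R)%:E)%E.
  apply: measurable_layer => //; exact: measurable_funB.
have E_I : (\int[P]_w \int[mu]_z (phi z * (x - z < X w)%R%:R)%:E =
    \int[mu]_(z in `[0%R, (x - D)%R]) (Fs z * tail F (x - z)%R)%:E)%E.
  rewrite (layer_cake X (k := fun z => x - z))//; last exact: measurable_funB.
  rewrite [RHS]integral_mkcond; apply: eq_integral => z _.
  rewrite patchE /phi indicE (ccdf_tail X_cdf).
  by case: ifPn => _; rewrite ?mulr1 ?mulr0 ?mul0e -?EFinM.
have E_excess : (\int[P]_w (excess X x w)%:E = (Fs x)%:E)%E.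
  by rewrite (integral_excess X_cdf) (EFin_integrated_tail X_cdf X_int).
have far_int := integrable_far_increment x D.
rewrite /Rintegral fineK; last exact: (integrable_fin_num measurableT far_int).
have mKI := @measurable_funeM _ _ _ setT _ K%:E mI.
have KI0 w : setT w ->
    (0 <= K%:E * \int[mu]_z (phi z * (x - z < X w)%R%:R)%:E)%E.
  by move=> _; rewrite mule_ge0.
have m_excess : measurable_fun setT (fun w => (excess X x w)%:E).
  by apply/measurable_EFinP; exact: measurable_excess.
have excess0 w : setT w -> (0 <= (excess X x w)%:E)%E.
  by move=> _; rewrite lee_fin excess_ge0.
rewrite -E_I -E_excess -ge0_integralZl_EFin// -ge0_integralD//.
apply: ge0_le_integral => //.
- move=> w _; rewrite lee_fin subr_ge0.
  apply: (primitive_nondecreasing h_nonincr h01).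
  by rewrite lerB// le_max lexx orbT.
- exact: measurable_int far_int.
- exact: emeasurable_funD.
- by move=> w _; exact: primitive_far_increment.
Qed.

End drift_bounds.

(** * Truncation of the jumps *)

Section drift_upper_bound.
Context d (T : measurableType d) (R : realType) (P : probability T R).
Variables (X : {RV P >-> R}) (F : R -> R).
Hypothesis X_cdf : forall x, cdf X x = (F x)%:E.
Hypothesis X_int : P.-integrable [set: T] (EFin \o X).
Local Notation mu := (@lebesgue_measure R).
Local Notation Fs := (integrated_tail F).

Lemma normr_clip_le (D c : R) : 0 <= D -> `|clip D c| <= `|c|.
Proof.
move=> D0; have [c0|c0] := ler0P c; rewrite /clip ler_norml.
  rewrite min_l; last lra.
  by have [?|?] := leP c (- D); apply/andP; split; lra.
rewrite max_l; last by rewrite le_min; apply/andP; split; lra.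
by have [?|?] := leP c D; apply/andP; split; lra.
Qed.

Lemma measurable_clip (D : R) : measurable_fun setT (fun w => clip D (X w)).
Proof. by apply: measurable_maxr => //; exact: measurable_minr. Qed.

Lemma integrable_clip (D : R) : 0 <= D ->
  P.-integrable [set: T] (EFin \o (fun w => clip D (X w))).
Proof.
move=> D0; apply: (integrable_affine_bound X_int (c := 0)) => [|w].
  exact: measurable_clip.
by rewrite add0r normr_clip_le.
Qed.

Lemma cvg_Rintegral_clip :
  \int[P]_w clip n%:R (X w) @[n --> \oo] --> \int[P]_w X w.
Proof.
have [] := @dominated_convergence _ _ _ P setT measurableT
  (fun n w => (clip n%:R (X w))%:E) (EFin \o X) (fun w => `|X w|%:E).
- by move=> n; apply/measurable_EFinP; exact: measurable_clip.
- exact/measurable_EFinP.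
- apply: nearW => w _; apply: cvg_near_cst.
  near=> n; have Xn : `|X w| <= n%:R by near: n; exact: nbhs_infty_ger.
  move: Xn; rewrite ler_norml => /andP[lo up].
  by rewrite /clip min_l// max_l.
- exact: (integrable_norm X_int).
- by apply: nearW => w n _; rewrite lee_fin normr_clip_le.
move=> _ _ lim; apply: fine_cvg.
by rewrite fineK//; exact: (integrable_fin_num measurableT X_int).
Unshelve. all: by end_near. Qed.

Variable h : R -> R.
Hypothesis h_nonincr : nonincreasing_fun h.
Hypothesis h01 : forall x, 0 <= h x <= 1.
Hypothesis h_neg : forall x : R, x < 0 -> h x = 1.

(** For a large [D] the mean of [clip D X] is close to that of [X], and [e] is
    small; the price is the variation of [h] over a window of width [2 * D]. *)
Lemma drift_upper_bound (x D K e : R) : 0 <= D -> D <= x -> 0 <= K ->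
  (forall y, 0 <= y -> y <= x -> h y <= K * Fs y) ->
  (\int[mu]_(z in `[0%R, (x - D)%R]) (Fs z * tail F (x - z)%R)%:E <=
     (e * Fs x)%:E)%E ->
  drift X h x <= \int[P]_w clip D (X w) * h (x + D) +
    \int[P]_w `|X w| * (h (x - D) - h (x + D)) + (K * e + 1) * Fs x.
Proof.
move=> D0 Dx K0 hK qe.
have i_norm := integrable_norm X_int.
have i_clip := integrable_clip D0.
have i_far := integrable_far_increment X_int h_nonincr h01 x D.
have far_le : \int[P]_w (primitive h (x - D) -
    primitive h (x - Num.max (X w) D)) <= (K * e + 1) * Fs x.
  rewrite -lee_fin; apply: le_trans.
    exact: (integral_far_increment X_cdf X_int h_nonincr h01 h_neg D0 Dx K0 hK).
  rewrite mulrDl mul1r EFinD leeD2r// -mulrA EFinM.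
  by apply: lee_wpmul2l => //; rewrite lee_fin.
rewrite [X in X + _ + _]mulrC [X in _ + X + _]mulrC.
rewrite -(RintegralZl _ measurableT i_norm) -(RintegralZl _ measurableT i_clip).
have i1 := integrableZl measurableT (h (x + D)) i_clip.
have i2 := integrableZl measurableT (h (x - D) - h (x + D)) i_norm.
rewrite -(RintegralD measurableT i1 i2).
apply: le_trans (lerD (lexx _) far_le).
have i12 := integrableD measurableT i1 i2.
rewrite -(RintegralD measurableT i12 i_far).
apply: (le_Rintegral measurableT (integrable_drift X_int h_nonincr h01 x)
  (integrableD measurableT i12 i_far)) => w _.
rewrite /= [X in X + _ + _]mulrC [X in _ + X + _]mulrC.
exact: primitive_increment_upper.
Qed.

End drift_upper_bound.

(** * Subexponentiality of the integrated tail *)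

Section strong_subexponential_tails.
Context d (T : measurableType d) (R : realType) (P : probability T R).
Variables (X : {RV P >-> R}) (F : R -> R).
Hypothesis X_cdf : forall x, cdf X x = (F x)%:E.
Hypothesis X_int : P.-integrable [set: T] (EFin \o X).
Local Notation mu := (@lebesgue_measure R).
Local Notation Fs := (integrated_tail F).

Let tail0 := tail_ge0 X_cdf.
Let tail1 := tail_le1 X_cdf.
Let mtail := measurable_tail X_cdf.
Let Fs0 := integrated_tail_ge0 X_cdf.

(** The integrand of the tail convolution for [z >= x], extended by 0 to the plane
    as Tonelli's theorem requires. *)
Let kernel (x : R) (zy : measurableTypeR R * measurableTypeR R) : R :=
  if [&& x <= zy.1, 0 <= zy.2 & zy.2 <= zy.1]
  then tail F (zy.1 - zy.2) * tail F zy.2 else 0.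

Let kernel_ge0 x zy : (0 <= (kernel x zy)%:E)%E.
Proof. by rewrite lee_fin /kernel; case: ifP => // _; exact: mulr_ge0. Qed.

Let measurable_kernel x : measurable_fun setT (EFin \o kernel x).
Proof.
apply/measurable_EFinP; apply: measurable_fun_ifT => //.
  apply: measurable_and; first exact: measurable_fun_ler.
  by apply: measurable_and; exact: measurable_fun_ler.
apply: measurable_funM; last exact: measurableT_comp.
by apply: measurableT_comp => //; exact: measurable_funB.
Qed.

Let integral_kernel x z : x <= z ->
  (\int[mu]_y (kernel x (z, y))%:E =
   \int[mu]_(y in `[0%R, z]) (tail F (z - y)%R * tail F y)%:E)%E.
Proof.
move=> xz; rewrite [RHS]integral_mkcond; apply: eq_integral => y _.
rewrite patchE /kernel/= xz /=; case: ifPn => [|/negP].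
  by move=> yz; rewrite ifT// in_setE/= in_itv.
by move=> yz; rewrite ifF//; apply/negP; rewrite in_setE/= in_itv.
Qed.

Let measurable_tail_convolution (x : R) :
  measurable_fun (`[x, +oo[%classic : set R) (fun z => \int[mu]_(y in `[0%R, z]) (tail F (z - y)%R * tail F y)%:E)%E.
Proof.
apply: (@eq_measurable_fun _ _ _ _ _ (fubini_F mu (EFin \o kernel x))) => [z|].
  by rewrite in_setE/= in_itv/= andbT => xz; exact: integral_kernel.
apply: measurable_funTS; apply: measurable_fun_fubini_tonelli_F => // zy.
exact: kernel_ge0.
Qed.

(** Exchanging the integrals, the inner one over [z >= max(x, y)] is
    [Fs (max(x - y, 0))]. The values [y <= x] give the convolution of [Fs] with
    the tail, and each value [y > x] contributes [Fs 0]. *)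
Lemma integral_tail_convolution (x : R) : 0 <= x ->
  (\int[mu]_(z in `[x, +oo[) \int[mu]_(y in `[0%R, z])
      (tail F (z - y)%R * tail F y)%:E =
   \int[mu]_(z in `[0%R, x]) (Fs z * tail F (x - z)%R)%:E + (Fs 0 * Fs x)%:E)%E.
Proof.
move=> x0; pose f := kernel x.
transitivity (\int[mu]_z \int[mu]_y (f (z, y))%:E)%E.
  rewrite [LHS]integral_mkcond; apply: eq_integral => z _.
  rewrite patchE; case: ifPn => [|/negP] zx; last first.
    rewrite integral0_eq// => y _; rewrite /f /kernel; case: ifP => // /andP[xz _].
    by exfalso; apply: zx; rewrite in_setE/= in_itv/= xz.
  by rewrite integral_kernel//; move: zx; rewrite in_setE/= in_itv/= andbT.
transitivity (\int[mu]_y \int[mu]_z (f (z, y))%:E)%E.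
  exact: (@fubini_tonelli _ _ _ _ _ mu mu (EFin \o f) (measurable_kernel x)
    (kernel_ge0 x)).
transitivity (\int[mu]_(y in `[0%R, +oo[) (tail F y * Fs (Num.max (x - y) 0))%:E)%E.
  rewrite [RHS]integral_mkcond; apply: eq_integral => y _.
  rewrite patchE; case: ifPn => [|/negP] y0; last first.
    rewrite integral0_eq// => z _; rewrite /f /kernel; case: ifP => // /and3P[_ yy _].
    by exfalso; apply: y0; rewrite in_setE/= in_itv/= yy.
  rewrite in_setE/= in_itv/= andbT in y0.
  set m := Num.max (x - y) 0.
  pose phi (u : R) := ((tail F u)%:E * (\1_(`[m, +oo[%classic : set R) u)%:E)%E.
  have mphi : measurable_fun setT phi.
    by apply: emeasurable_funM; apply/measurable_EFinP.
  have phi0 u : (0 <= phi u)%E by rewrite mule_ge0 ?lee_fin.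
  transitivity (\int[mu]_z ((tail F y)%:E * phi (z - y)%R))%E.
    apply: eq_integral => z _; rewrite /phi indicE /f /kernel y0/=.
    have -> : (z - y \in (`[m, +oo[%classic : set R)) = (x <= z) && (y <= z).
      apply/idP/idP; rewrite in_setE/= in_itv/= andbT /m ge_max.
        by move=> /andP[? ?]; apply/andP; split; lra.
      by move=> /andP[? ?]; apply/andP; split; lra.
    by case: ifP => _; rewrite ?mule1 ?mule0// -EFinM mulrC.
  rewrite ge0_integralZl_EFin//; last first.
    by apply: (measurableT_comp mphi); exact: measurable_funB.
  rewrite ge0_integral_translate// EFinM; congr (_ * _)%E.
  rewrite (EFin_integrated_tail X_cdf X_int) [RHS]integral_mkcond.
  apply: eq_integral => u _; rewrite /phi patchE indicE.
  by case: ifP => _; rewrite ?mule1 ?mule0.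
have mG : measurable_fun setT (fun y => (tail F y * Fs (Num.max (x - y) 0))%:E).
  apply/measurable_EFinP; apply: measurable_funM => //.
  apply: measurableT_comp; first exact: (measurable_integrated_tail X_cdf).
  by apply: measurable_maxr => //; exact: measurable_funB.
rewrite (@itv_bndbnd_setU _ _ _ (BRight x)); [|by rewrite bnd_simp..].
rewrite ge0_integral_setU//; last 3 first.
- exact: measurable_funTS.
- by move=> y _; rewrite lee_fin mulr_ge0.
- apply/disj_setPS => y [/=]; rewrite !in_itv/= andbT => /andP[_ yx].
  by rewrite ltNge yx.
congr (_ + _)%E.
  pose psi (y : R) := (tail F y * Fs (Num.max (x - y) 0) *
    \1_(`[0, x]%classic : set R) y)%:E.
  transitivity (\int[mu]_y psi y)%E.
    rewrite integral_mkcond; apply: eq_integral => y _.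
    by rewrite patchE /psi indicE; case: ifP => _; rewrite ?mulr1 ?mulr0.
  rewrite -(ge0_integral_reflect x); last 2 first.
  - rewrite (_ : psi = fun y => ((tail F y * Fs (Num.max (x - y) 0))%:E *
      (\1_(`[0, x]%classic : set R) y)%:E)%E).
      by apply: emeasurable_funM => //; exact/measurable_EFinP.
    by apply/funext => y; rewrite -EFinM.
  - by move=> y; rewrite lee_fin !mulr_ge0.
  rewrite [RHS]integral_mkcond; apply: eq_integral => z _.
  rewrite patchE /psi indicE.
  have -> : (x - z \in (`[0, x]%classic : set R)) = (z \in (`[0, x]%classic : set R)).
    apply/idP/idP; rewrite !in_setE/= !in_itv/= => /andP[? ?];
      by apply/andP; split; lra.
  rewrite (_ : x - (x - z) = z); last lra.
  case: ifP; rewrite ?mulr0// mulr1 in_setE/= in_itv/= => /andP[z0 _].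
  by rewrite max_l// mulrC.
rewrite integral_itv_obnd_cbnd; last exact: measurable_funTS.
rewrite EFinM (EFin_integrated_tail X_cdf X_int x) -ge0_integralZl_EFin//.
- apply: eq_integral => y; rewrite in_setE/= in_itv/= andbT => xy.
  by rewrite max_r ?subr_le0// mulrC.
- by move=> y _; rewrite lee_fin.
- by apply/measurable_EFinP; exact: measurable_funTS.
Qed.

Lemma tail_mass_EFin : tail_mass F = (Fs 0)%:E.
Proof. by rewrite (EFin_integrated_tail X_cdf X_int). Qed.

Lemma EFin_tail_convolution (z : R) :
  ((\int[mu]_(y in `[0, z]) (tail F (z - y) * tail F y))%:E =
   \int[mu]_(y in `[0%R, z]) (tail F (z - y)%R * tail F y)%:E)%E.
Proof.
have conv_int : mu.-integrable `[0, z]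
    (EFin \o (fun y => tail F (z - y) * tail F y)); last first.
  by rewrite /Rintegral fineK//; exact: (integrable_fin_num _ conv_int).
apply: measurable_bounded_integrable => //.
- by rewrite /= lebesgue_measure_itv/=; case: ifP => // _; rewrite -EFinD ltry.
- apply: measurable_funTS; apply: measurable_funM => //.
  by apply: measurableT_comp => //; exact: measurable_funB.
- exists 1; split; first exact: num_real.
  move=> M M1 y _ /=; rewrite ger0_norm ?mulr_ge0//.
  by apply: le_trans (ltW M1); exact: mulr_ile1.
Qed.

Hypothesis F_strong : strong_subexponential F.

(** The tail is positive because the quotient would be 0, away from its limit 1,
    if the denominator vanished. *)
Lemma strong_subexponential_near (e : R) : 0 < e ->
  \forall x \near +oo, 0 < tail F x /\
    \int[mu]_(y in `[0, x]) (tail F (x - y) * tail F y) <=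
    2 * Fs 0 * (1 + e) * tail F x.
Proof.
move=> e0; have [] := F_strong; rewrite tail_mass_EFin /asymp_equiv /= => /andP[m0 _].
have {}m0 : 0 < Fs 0 by rewrite -lte_fin.
have em0 : 0 < Num.min e (1/2) by rewrite lt_min e0 divr_gt0.
move=> /cvgrPdist_le/(_ _ em0); apply: filterS => x.
move: (\int[mu]_(y in `[0, x]) _) => I.
rewrite le_min => /andP[Ie I1].
have t0 : 0 < tail F x.
  rewrite lt_neqAle tail0 andbT eq_sym; apply/eqP => tx; move: I1.
  by rewrite tx mulr0 invr0 mulr0 subr0 normr1; lra.
split => //; have g0 : 0 < 2 * Fs 0 * tail F x by rewrite !mulr_gt0.
have : I / (2 * Fs 0 * tail F x) <= 1 + e.
  by move: Ie; rewrite ler_distl => /andP[]; lra.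
rewrite ler_pdivrMr// => /le_trans; apply.
by rewrite mulrC mulrAC.
Qed.

Lemma strong_subexponential_tail_gt0 (x : R) : 0 < tail F x.
Proof.
have [N [_ +]] := strong_subexponential_near ltr01.
move=> /(_ (Num.max N x + 1)) [].
  by rewrite (le_lt_trans (y := Num.max N x)) ?le_max ?lexx// ltrDl.
move=> /lt_le_trans + _; apply; apply: (tail_nonincreasing X_cdf).
by rewrite (le_trans (y := Num.max N x)) ?le_max ?lexx ?orbT// lerDl.
Qed.

Let t_gt0 := strong_subexponential_tail_gt0.

(** Integrating the bound of [strong_subexponential_near] from [x] to infinity
    gives [Q + Fs 0 * Fs x <= 2 * Fs 0 * (1 + e') * Fs x] with [Q] the left-hand
    side, by [integral_tail_convolution]. *)
Lemma integrated_tail_subexponential (e : R) : 0 < e ->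
  \forall x \near +oo,
    (\int[mu]_(z in `[0%R, x]) (Fs z * tail F (x - z)%R)%:E <=
     ((Fs 0 + e) * Fs x)%:E)%E.
Proof.
move=> e0.
have m0 : 0 < Fs 0 by exact: (integrated_tail_gt0 X_cdf X_int).
have e'0 : 0 < e / (2 * Fs 0) by rewrite divr_gt0// mulr_gt0.
have [N [_ NP]] := strong_subexponential_near e'0.
near=> x.
have x0 : 0 <= x by near: x; exact: nbhs_pinfty_ge.
have Nx : N < x by near: x; apply: nbhs_pinfty_gt; exact: num_real.
rewrite -(@leeD2rE _ (Fs 0 * Fs x)%:E)// -integral_tail_convolution//.
apply: (@le_trans _ _ (\int[mu]_(z in `[x, +oo[)
    ((2 * Fs 0 * (1 + e / (2 * Fs 0)))%:E * (tail F z)%:E))%E).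
  apply: ge0_le_integral => //.
  - by move=> z _; apply: integral_ge0 => y _; rewrite lee_fin mulr_ge0.
  - exact: measurable_tail_convolution.
  - by apply: measurable_funTS; apply: measurable_funeM; exact/measurable_EFinP.
  - move=> z /=; rewrite in_itv/= andbT => xz.
    rewrite -EFin_tail_convolution -EFinM lee_fin.
    by have [] := NP z (lt_le_trans Nx xz).
rewrite ge0_integralZl_EFin//.
- rewrite -(EFin_integrated_tail X_cdf X_int) -EFinM -EFinD lee_fin.
  have -> : 2 * Fs 0 * (1 + e / (2 * Fs 0)) = 2 * Fs 0 + e.
    by field; rewrite gt_eqF.
  by rewrite -mulrDl; lra.
- by move=> z _; rewrite lee_fin.
- by apply/measurable_EFinP; exact: measurable_funTS.
- by rewrite !mulr_ge0// ?addr_ge0// ltW.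
Unshelve. all: by end_near. Qed.

Let measurable_tail_reflect (x : R) (A : set R) :
  measurable A -> measurable_fun A (fun z => (tail F (x - z))%:E).
Proof.
move=> mA; apply/measurable_EFinP; apply: measurable_funTS.
by apply: measurableT_comp => //; exact: measurable_funB.
Qed.

Let measurable_conv (x : R) (A : set R) :
  measurable A -> measurable_fun A (fun z => (Fs z * tail F (x - z))%:E).
Proof.
move=> mA; apply/measurable_EFinP; apply: measurable_funTS.
apply: measurable_funM; first exact: (measurable_integrated_tail X_cdf).
by apply: measurableT_comp => //; exact: measurable_funB.
Qed.

Lemma integral_tail_reflect_itv (x u v : R) : u <= v ->
  (\int[mu]_(z in `](x - v)%R, (x - u)%R]) (tail F (x - z)%R)%:E =
   (Fs u - Fs v)%:E)%E.
Proof.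
move=> uv.
pose phi (y : R) := ((tail F y)%:E * (\1_(`[u, v[%classic : set R) y)%:E)%E.
have mphi : measurable_fun setT phi.
  by apply: emeasurable_funM; apply/measurable_EFinP.
have phi0 y : (0 <= phi y)%E by rewrite mule_ge0 ?lee_fin.
have phiE : (\int[mu]_y phi y = \int[mu]_(y in `[u, v[) (tail F y)%:E)%E.
  rewrite [RHS]integral_mkcond; apply: eq_integral => y _.
  by rewrite /phi patchE indicE; case: ifP => _; rewrite ?mule1 ?mule0.
transitivity (\int[mu]_y phi y)%E.
  rewrite -(ge0_integral_reflect x)// [LHS]integral_mkcond.
  apply: eq_integral => z _; rewrite patchE /phi indicE.
  have -> : (x - z \in (`[u, v[%classic : set R)) =
      (z \in (`]x - v, x - u]%classic : set R)).
    apply/idP/idP; rewrite !in_setE/= !in_itv/= => /andP[? ?];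
      by apply/andP; split; lra.
  by case: ifP => _; rewrite ?mule1 ?mule0.
have split_uv : ((Fs u)%:E = \int[mu]_(y in `[u, v[) (tail F y)%:E + (Fs v)%:E)%E.
  rewrite !(EFin_integrated_tail X_cdf X_int).
  rewrite (@itv_bndbnd_setU _ _ _ (BLeft v)); [|by rewrite bnd_simp..].
  rewrite ge0_integral_setU//.
  - by apply/measurable_EFinP; exact: measurable_funTS.
  - by move=> y _; rewrite lee_fin.
  - apply/disj_setPS => y [/=]; rewrite !in_itv/= andbT => /andP[_ yv].
    by rewrite leNgt yv.
by rewrite phiE EFinB split_uv addeK.
Qed.

Let tail_convolution_piece (x u v k : R) : u <= v -> 0 <= k ->
  (forall z, x - v < z -> z <= x - u -> k <= Fs z) ->
  ((k * (Fs u - Fs v))%:E <=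
   \int[mu]_(z in `](x - v)%R, (x - u)%R]) (Fs z * tail F (x - z)%R)%:E)%E.
Proof.
move=> uv k0 kFs.
apply: (@le_trans _ _ (\int[mu]_(z in `](x - v)%R, (x - u)%R])
    (k%:E * (tail F (x - z)%R)%:E))%E); last first.
  apply: ge0_le_integral => //.
  - by move=> z _; rewrite -EFinM lee_fin mulr_ge0.
  - by apply: measurable_funeM; exact: measurable_tail_reflect.
  - exact: measurable_conv.
  - move=> z /=; rewrite in_itv/= => /andP[vz zu].
    by rewrite -EFinM lee_fin ler_wpM2r// kFs.
rewrite ge0_integralZl_EFin//.
- by rewrite integral_tail_reflect_itv// -EFinM.
- by move=> z _; rewrite lee_fin.
- exact: measurable_tail_reflect.
Qed.

(** The last stretch [z > x - D] already contributes at least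
    [(Fs 0 - Fs D) * Fs x] to the whole convolution, which is at most
    [(Fs 0 + e) * Fs x]. *)
Lemma integrated_tail_far_convolution (D e : R) : 0 <= D -> 0 < e ->
  \forall x \near +oo,
    (\int[mu]_(z in `[0%R, (x - D)%R]) (Fs z * tail F (x - z)%R)%:E <=
     ((Fs D + e) * Fs x)%:E)%E.
Proof.
move=> D0 e0; near=> x.
have Dx : D <= x by near: x; apply: nbhs_pinfty_ge; exact: num_real.
have : (\int[mu]_(z in `[0%R, x]) (Fs z * tail F (x - z)%R)%:E <=
     ((Fs 0 + e) * Fs x)%:E)%E.
  by near: x; exact: integrated_tail_subexponential.
rewrite (@itv_bndbnd_setU _ _ _ (BRight (x - D))); [|by rewrite bnd_simp; lra..].
rewrite ge0_integral_setU//; last 3 first.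
- by apply: measurable_conv; exact: measurableU.
- by move=> z _; rewrite lee_fin mulr_ge0.
- apply/disj_setPS => z [/=]; rewrite !in_itv/= => /andP[_ zx] /andP[].
  by rewrite ltNge zx.
have near_x : ((Fs x * (Fs 0 - Fs D))%:E <=
    \int[mu]_(z in `](x - D)%R, x]) (Fs z * tail F (x - z)%R)%:E)%E.
  rewrite -[X in (_ <= \int[mu]_(z in `]_, X]) _)%E]subr0.
  apply: tail_convolution_piece => // z _; rewrite subr0.
  exact: (integrated_tail_nonincreasing X_cdf).
move=> /(le_trans (leeD2l _ near_x)).
rewrite -leeBrDr// -EFinB => /le_trans; apply; rewrite lee_fin.
move: (Fs 0) (Fs D) (Fs x) => p q r; lra.
Unshelve. all: by end_near. Qed.

(** On [[0, x - c]] the convolution is at least [Fs (x - c) * (Fs c - Fs x)] and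
    at most [(Fs c + e1) * Fs x]; here [Fs x] tends to 0. *)
Lemma integrated_tail_long_tailed (c e : R) : 0 <= c -> 0 < e ->
  \forall x \near +oo, Fs (x - c) <= (1 + e) * Fs x.
Proof.
move=> c0 e0; have Fsc : 0 < Fs c by exact: (integrated_tail_gt0 X_cdf X_int).
(* this e1 solves [Fs c + e1 = (1 + e) * (Fs c - e1)] *)
pose e1 := Fs c * e / (2 + e).
have e10 : 0 < e1 by rewrite divr_gt0 ?mulr_gt0//; lra.
near=> x.
have cx : c <= x by near: x; apply: nbhs_pinfty_ge; exact: num_real.
have Fsx : Fs x <= e1.
  near: x; have /cvgrPdist_le/(_ _ e10) := integrated_tail_cvg0 X_cdf X_int.
  by apply: filterS => x; rewrite sub0r normrN ger0_norm.
have : (\int[mu]_(z in `[0%R, (x - c)%R]) (Fs z * tail F (x - z)%R)%:E <=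
     ((Fs c + e1) * Fs x)%:E)%E.
  by near: x; exact: integrated_tail_far_convolution.
have far_x : ((Fs (x - c) * (Fs c - Fs x))%:E <=
    \int[mu]_(z in `[0%R, (x - c)%R]) (Fs z * tail F (x - z)%R)%:E)%E.
  apply: (@le_trans _ _ (\int[mu]_(z in `](x - x)%R, (x - c)%R])
      (Fs z * tail F (x - z)%R)%:E)%E).
    apply: tail_convolution_piece => // z _.
    exact: (integrated_tail_nonincreasing X_cdf).
  rewrite subrr; apply: ge0_subset_integral => //.
  - exact: measurable_conv.
  - by move=> z _; rewrite lee_fin mulr_ge0.
  - by move=> z /=; rewrite !in_itv/= => /andP[/ltW -> ->].
move=> /(le_trans far_x); rewrite lee_fin.
have s0 : 0 < Fs c - e1.
  have -> : Fs c - e1 = Fs c * (2 / (2 + e)) by rewrite /e1; field; lra.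
  by rewrite mulr_gt0// divr_gt0//; lra.
have -> : Fs c + e1 = (1 + e) * (Fs c - e1) by rewrite /e1; field; lra.
rewrite mulrAC => le_prod; rewrite -(ler_pM2r s0); apply: le_trans le_prod.
by rewrite ler_wpM2l// lerB.
Unshelve. all: by end_near. Qed.

End strong_subexponential_tails.

(** * Averaging the truncated inequality *)

Section averaging.
Context d (T : measurableType d) (R : realType) (P : probability T R).
Variables (X : {RV P >-> R}) (F : R -> R) (a : R).
Hypothesis X_cdf : forall x, cdf X x = (F x)%:E.
Hypothesis X_int : P.-integrable [set: T] (EFin \o X).
Hypothesis X_mean : \int[P]_w X w = - a.
Hypothesis a_gt0 : 0 < a.
Hypothesis F_strong : strong_subexponential F.
Local Notation Fs := (integrated_tail F).

Let Fs_gt0 := integrated_tail_gt0 X_cdf X_int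
  (strong_subexponential_tail_gt0 X_cdf X_int F_strong).
Let Fs_ge0 x : 0 <= Fs x. Proof. exact: ltW. Qed.
Let Fs_nonincr := integrated_tail_nonincreasing X_cdf X_int.

(** What the tails of all finite maxima of the walk have in common. The bounds
    below are uniform over this class, hence in the length of the walk. *)
Definition submean_tail (h : R -> R) : Prop :=
  [/\ nonincreasing_fun h, forall x, 0 <= h x <= 1,
      forall x : R, x < 0 -> h x = 1 & forall x, 0 <= x -> 0 <= drift X h x].

Lemma submean_tail_step (e : R) : 0 < e ->
  exists D b : R, [/\ 0 <= D, 0 <= b & \forall x \near +oo,
    forall (h : R -> R) (K : R), submean_tail h -> 0 <= K ->
    (forall y, 0 <= y -> y <= x -> h y <= K * Fs y) ->
    (a - e) * h (x + D) <= b * (h (x - D) - h (x + D)) + (K * e + 1) * Fs x].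
Proof.
move=> e0; have e20 : 0 < e / 2 by rewrite divr_gt0.
have [N1 _ N1P] : \forall n \near \oo, \int[P]_w clip n%:R (X w) <= - a + e.
  have /cvgrPdist_le/(_ e e0) := cvg_Rintegral_clip X_int.
  by apply: filterS => n; rewrite X_mean ler_distlC => /andP[].
have [N2 [_ N2P]] : \forall x \near +oo, Fs x <= e / 2.
  have /cvgrPdist_le/(_ _ e20) := integrated_tail_cvg0 X_cdf X_int.
  by apply: filterS => x; rewrite sub0r normrN ger0_norm.
pose n := maxn N1 (Num.bound `|N2|).
have FsD : Fs n%:R <= e / 2.
  apply: N2P; rewrite (le_lt_trans (ler_norm _))//.
  rewrite (lt_le_trans (archi_boundP (normr_ge0 _)))//.
  by rewrite ler_nat leq_maxr.
exists n%:R, (\int[P]_w `|X w|); split => //.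
  by apply: Rintegral_ge0.
near=> x => h K [h_nonincr h01 h_neg drift0] K0 hK.
have nx : n%:R <= x by near: x; apply: nbhs_pinfty_ge; exact: num_real.
have x0 : 0 <= x by exact: le_trans nx.
have far : (\int[lebesgue_measure]_(z in `[0%R, (x - n%:R)%R])
    (Fs z * tail F (x - z)%R)%:E <= (e * Fs x)%:E)%E.
  apply: (@le_trans _ _ ((Fs n%:R + e / 2) * Fs x)%:E).
    by near: x; exact: (integrated_tail_far_convolution X_cdf X_int F_strong).
  by rewrite lee_fin ler_wpM2r//; lra.
have := le_trans (drift0 x x0)
  (drift_upper_bound X_cdf X_int h_nonincr h01 h_neg (ler0n _ n) nx K0 hK far).
have : \int[P]_w clip n%:R (X w) * h (x + n%:R) <= (- a + e) * h (x + n%:R).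
  apply: ler_wpM2r; first by have /andP[] := h01 (x + n%:R).
  by apply: N1P; exact: leq_maxl.
move: (\int[P]_w clip _ _ * _) (\int[P]_w `|X w| * _) (_ * Fs x) => p q r; lra.
Unshelve. all: by end_near. Qed.

(** [submean_tail_step] at the points [x - c + (2 j + 1) D], for [j < J], with
    [c = 2 J D]: the windows of half-width [D] around them are adjacent, so that
    the differences sum to at most [h (x - c) <= K * Fs (x - c)], while each
    left-hand side is at least [(a - eta) * h x]. Dividing by [J] makes this sum
    harmless, and [Fs (x - c)] is close to [Fs x]. *)
Lemma submean_tail_averaged (e : R) : 0 < e ->
  exists2 x0 : R, 0 <= x0 & forall (h : R -> R) (K x : R), x0 <= x ->
    submean_tail h -> 0 <= K ->
    (forall y, 0 <= y -> y <= x -> h y <= K * Fs y) ->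
    h x <= ((1 + e) / a + e * K) * Fs x.
Proof.
move=> e0.
pose eta := Num.min (Num.min 1 (a / 2))
  (Num.min (a * e / 8) (a * e / (1 + e + a))).
have ae0 : 0 < a * e by exact: mulr_gt0.
have ea0 : 0 < 1 + e + a by rewrite !addr_gt0.
have eta0 : 0 < eta by rewrite !lt_min ltr01 !divr_gt0.
(* small enough for [(1 + eta) / (a - eta) <= (1 + e) / a] and
     [2 * eta * (1 + eta) / (a - eta) <= e] *)
have [eta1 eta_a eta_ae eta_ae'] :
    [/\ eta <= 1, eta <= a / 2, eta <= a * e / 8 & eta * (1 + e + a) <= a * e].
  rewrite -ler_pdivlMr//.
  by split; rewrite !ge_min ?lexx ?orbT.
have [D [b [D0 b0 [N [_ step]]]]] := submean_tail_step eta0.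
pose J := (Num.bound (b / eta)).+1.
have J0 : 0 < J%:R :> R by rewrite ltr0n.
have bJ : b <= eta * J%:R.
  rewrite mulrC -ler_pdivrMr// ltW//; apply: lt_le_trans (archi_boundP _) _.
    exact: divr_ge0 (ltW _).
  by rewrite ler_nat.
pose c := 2 * J%:R * D.
have c0 : 0 <= c by rewrite !mulr_ge0.
have [N' [_ long]] := integrated_tail_long_tailed X_cdf X_int F_strong c0 eta0.
pose x0 := Num.max (Num.max N 0 + c) (Num.max N' 0) + 1.
exists x0.
  by rewrite addr_ge0// le_max [0 <= Num.max N' 0]le_max lexx !orbT.
move=> h K x x0x hT K0 hK.
have [h_nonincr h01 _ _] := hT.
have [Ny y0 N'x] : [/\ N < x - c, 0 <= x - c & N' < x].
  move: x0x; rewrite /x0 -lerBrDr !ge_max => /andP[+ /andP[N'x _]].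
  rewrite -lerBrDr ge_max => /andP[Nx x1].
  by split; lra.
set y := x - c in Ny y0.
pose p (j : nat) := h (y + 2 * j%:R * D).
pose S := (K * eta + 1) * Fs y.
have pj j : (j < J)%N -> (a - eta) * p J <= b * (p j - p j.+1) + S.
  move=> jJ; pose xj := y + (2 * j%:R + 1) * D.
  have j0 : 0 <= j%:R :> R by [].
  have jJR : j%:R + 1 <= J%:R :> R by rewrite natr1 ler_nat.
  have yxj : y <= xj by rewrite lerDl mulr_ge0//; lra.
  have xjx : xj <= x.
    rewrite /xj /y /c; have : (j%:R + 1) * D <= J%:R * D by rewrite ler_wpM2r.
    by lra.
  have := step xj (lt_le_trans Ny yxj) h K hT K0.
  have -> : xj + D = y + 2 * j.+1%:R * D by rewrite /xj -natr1; ring.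
  have -> : xj - D = y + 2 * j%:R * D by rewrite /xj; ring.
  have hKj z : 0 <= z -> z <= xj -> h z <= K * Fs z.
    by move=> z0 /le_trans zx; apply: hK => //; exact: zx.
  move=> /(_ hKj).
  have pJj : p J <= p j.+1.
    apply: h_nonincr; rewrite lerD2l ler_wpM2r// ler_wpM2l// ler_nat//.
  have : (a - eta) * p J <= (a - eta) * p j.+1 by rewrite ler_wpM2l//; lra.
  have : (K * eta + 1) * Fs xj <= S.
    by rewrite ler_wpM2l ?Fs_nonincr// addr_ge0// mulr_ge0// ltW.
  rewrite -/(p j) -/(p j.+1).
  by move: (_ * Fs xj) ((a - eta) * _) ((a - eta) * _) => q r s; lra.
have sum_p : J%:R * ((a - eta) * p J) <= b * (p 0%N - p J) + J%:R * S.
  have -> : J%:R * ((a - eta) * p J) = \sum_(0 <= j < J) (a - eta) * p J.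
    by rewrite sumr_const_nat subn0 mulr_natl.
  have -> : b * (p 0%N - p J) + J%:R * S =
      \sum_(0 <= j < J) (b * (p j - p j.+1) + S).
    rewrite big_split/= sumr_const_nat subn0 mulr_natl; congr (_ + _).
    rewrite -big_distrr/=; congr (_ * _).
    rewrite -opprB -(telescope_sumr p (leq0n J)) -sumrN.
    by apply: eq_bigr => j _; rewrite opprB.
  by rewrite big_nat [leRHS]big_nat; apply: ler_sum => j /andP[_]; exact: pj.
have pJ : p J = h x by rewrite /p /y /c; congr h; lra.
have p0 : p 0%N <= K * Fs y.
  by rewrite /p mulr0 mul0r addr0 hK// /y; lra.
have Fsy : Fs y <= (1 + eta) * Fs x by exact: long.
have hx0 : 0 <= h x by have /andP[] := h01 x.
have bp : b * (p 0%N - p J) <= eta * J%:R * (K * Fs y).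
  apply: (@le_trans _ _ (b * (K * Fs y))).
    by rewrite ler_wpM2l// pJ; lra.
  by rewrite ler_wpM2r// mulr_ge0.
have main : (a - eta) * h x <= (2 * eta * K + 1) * Fs y.
  rewrite -(ler_pM2l J0) -pJ; apply: (le_trans sum_p).
  rewrite (le_trans (lerD bp (lexx _)))// /S.
  by rewrite le_eqVlt; apply/orP; left; apply/eqP; ring.
have ae : 0 < a - eta by lra.
rewrite -(ler_pM2l ae); apply: (le_trans main).
apply: (@le_trans _ _ ((2 * eta * K + 1) * ((1 + eta) * Fs x))).
  by rewrite ler_wpM2l// addr_ge0// mulr_ge0// mulr_ge0// ltW.
rewrite !mulrA ler_wpM2r// mulrDl mul1r.
have A : 1 + eta <= (a - eta) * ((1 + e) / a).
  rewrite mulrA ler_pdivlMr//; move: eta_ae'; nra.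
have B : 2 * eta * (1 + eta) <= (a - eta) * e.
  have : eta * eta <= eta by rewrite ler_piMr// ltW.
  have : (a / 2) * e <= (a - eta) * e by rewrite ler_wpM2r ?(ltW e0)//; lra.
  move: eta_ae; nra.
have : 2 * eta * (1 + eta) * K <= (a - eta) * e * K by rewrite ler_wpM2r.
by move: A; nra.
Qed.

(** On [[0, x]] the constant [1 / Fs x] is valid since [h <= 1]. With [e = 1/2],
    the averaged bound halves the excess of a valid constant over [B], and [B]
    does not depend on [x]. *)
Lemma submean_tail_bounded : exists2 B : R, 0 <= B &
  forall (h : R -> R) (x : R), submean_tail h -> 0 <= x -> h x <= B * Fs x.
Proof.
have half0 : (0 : R) < 1/2 by rewrite divr_gt0.
have [x0 x00 avg] := submean_tail_averaged half0.
pose B := Num.max (Fs x0)^-1 (3 / a).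
have B0 : 0 <= B by rewrite le_max invr_ge0 Fs_ge0.
exists B => // h x hT x_ge0; have [h_nonincr h01 _ _] := hT.
have h0 y : 0 <= h y by have /andP[] := h01 y.
have h1 y : h y <= 1 by have /andP[] := h01 y.
pose valid K := forall y, 0 <= y -> y <= x -> h y <= K * Fs y.
(* a valid constant B + t on [0, x] can be improved to B + t / 2 *)
have improve t : 0 <= t -> valid (B + t) -> valid (B + t / 2).
  move=> t0 Bt y y0 yx; have [yx0|x0y] := leP y x0.
    apply: (le_trans (h1 y)); apply: (@le_trans _ _ ((Fs x0)^-1 * Fs y)).
      by rewrite ler_pdivlMl// mulr1 Fs_nonincr.
    rewrite ler_wpM2r//; have : (Fs x0)^-1 <= B by rewrite le_max lexx.
    by lra.
  apply: (@le_trans _ _ (((1 + 1/2) / a + 1/2 * (B + t)) * Fs y)).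
    apply: avg => //; [exact: ltW|exact: addr_ge0|].
    by move=> z z0 /le_trans zy; apply: Bt => //; exact: zy.
  rewrite ler_wpM2r//; have : 3 / a <= B by rewrite le_max lexx orbT.
  by lra.
have valid_n n : valid (B + (Fs x)^-1 / 2 ^+ n).
  elim: n => [|n IHn].
    rewrite expr0 divr1 => y y0 yx; apply: (le_trans (h1 y)).
    rewrite mulrDl; apply: (@le_trans _ _ ((Fs x)^-1 * Fs y)).
      by rewrite ler_pdivlMl// mulr1 Fs_nonincr.
    by rewrite lerDr mulr_ge0.
  rewrite exprSr invfM mulrA; apply: improve => //.
  by rewrite divr_ge0 ?invr_ge0// exprn_ge0.
apply/ler_addgt0Pr => e e0.
have ne := archi_boundP (ltW (divr_gt0 ltr01 e0)).
have := valid_n (Num.bound (1 / e)) x x_ge0 (lexx x).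
set n := Num.bound _ in ne *.
move=> /le_trans; apply; rewrite mulrDl lerD2l mulrAC mulVf ?gt_eqF//.
rewrite mul1r -[e]invrK lef_pV2 ?posrE ?exprn_gt0 ?invr_gt0//.
rewrite (le_trans (ltW _) (_ : n%:R <= _))//; first by rewrite -div1r.
by rewrite -natrX ler_nat ltnW// ltn_expl.
Qed.

Lemma submean_tail_limsup (e : R) : 0 < e -> \forall x \near +oo,
  forall h, submean_tail h -> h x <= (1 + e) / a * Fs x.
Proof.
move=> e0; have [B B0 hB] := submean_tail_bounded.
have aB0 : 0 < 1 + a * B by rewrite ltr_pwDl// mulr_ge0// ltW.
have e'0 : 0 < e / (1 + a * B) by rewrite divr_gt0.
have [x0 x00 avg] := submean_tail_averaged e'0.
near=> x => h hT.
have x0x : x0 <= x by near: x; apply: nbhs_pinfty_ge; exact: num_real.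
apply: (le_trans (avg h B x x0x hT B0 _)); first by move=> y y0 _; exact: hB.
rewrite ler_wpM2r// le_eqVlt; apply/orP; left; apply/eqP.
by field; rewrite !gt_eqF.
Unshelve. all: by end_near. Qed.

End averaging.

(** * Laws and joint laws *)

Section laws.
Context d (T : measurableType d) (R : realType) (P : probability T R).

Lemma eq_cdf_distribution (X Y : {RV P >-> R}) (A : set R) :
  (forall x, cdf X x = cdf Y x) -> measurable A ->
  distribution P X A = distribution P Y A.
Proof.
move=> XY; apply: (measure_unique (@RGenOInfty.G R)
  (fun n => `](- n%:R)%R, +oo[%classic)).
- exact: RGenOInfty.measurableE.
- move=> _ _ [x ->] [y ->]; exists (Num.max x y).
  by apply/seteqP; split => z /=; rewrite !in_itv/= !andbT gt_max => /andP.
- by move=> n; exists (- n%:R).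
- apply/seteqP; split => // x _; exists (Num.bound `|x|) => //=.
  rewrite in_itv/= andbT ltrNl (le_lt_trans (ler_norm _))// normrN.
  exact: archi_boundP.
- move=> _ [x ->]; suff : ccdf X x = ccdf Y x by [].
  by rewrite !ccdf_1_cdf XY.
- by move=> n; rewrite (le_lt_trans (probability_le1 _ _))// ltry.
Qed.

(** [E] stands for an event of the past. Scaling the law of [U] by [P E] makes
    the uniqueness of product measures yield the independence of [U] and [V]
    and their independence of [E] at once. *)
Lemma joint_law_of_rectangles (E : set T) (U V : {RV P >-> R})
    (D : set (R * R)) : measurable E ->
  (forall A B, measurable A -> measurable B ->
    P (E `&` (U @^-1` A `&` V @^-1` B)) =
    (P E * (distribution P U A * distribution P V B))%E) ->
  measurable D ->
  P (E `&` (fun w => (U w, V w)) @^-1` D) =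
    (P E * (distribution P U \x distribution P V)%E D)%E.
Proof.
move=> mE rect mD.
have PE0 : 0 <= fine (P E) by exact: fine_ge0.
have PEE : (fine (P E))%:E = P E by rewrite fineK// fin_num_measure.
pose r := NngNum PE0.
have -> : (P E * (distribution P U \x distribution P V) D =
    (mscale r (distribution P U) \x distribution P V) D)%E.
  rewrite [RHS]ge0_integral_mscale//; last exact: measurable_fun_xsection.
  by rewrite /= PEE.
rewrite setIC -/(mrestr P mE _) -/(pushforward (mrestr P mE) _ _).
apply/esym; apply: product_measure_unique => //.
  exact: measurable_fun_pair.
move=> mUV A B mA mB; rewrite /= /pushforward /mrestr setIC.
by rewrite rect// /mscale/= PEE muleA.
Qed.

End laws.

(** * Finite maxima of the walk *)

Section walk_maximum.
Context d (T : measurableType d) (R : realType) (P : probability T R).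
Variable xi : nat -> {RV P >-> R}.

(** The maximum of the sums of [xi k.+1, ..., xi (k + m)] over [m <= n].
    Splitting off the first increment rather than the last leaves a walk of the
    same kind started one index later and independent of that increment. *)
Fixpoint walk_max (n k : nat) (w : T) : R :=
  if n is n'.+1 then Num.max 0 (xi k.+1 w + walk_max n' k.+1 w) else 0.

Lemma measurable_walk_max n k : measurable_fun setT (walk_max n k).
Proof.
elim: n k => [|n IHn] k; first exact: measurable_cst.
by apply: measurable_maxr => //; apply: measurable_funD => //; exact: IHn.
Qed.

HB.instance Definition _ n k :=
  @isMeasurableFun.Build _ _ _ _ (walk_max n k) (measurable_walk_max n k).

Lemma walk_max_gtP n k (w : T) (x : R) : x < walk_max n k w <->
  exists2 m, (m <= n)%N & x < \sum_(k.+1 <= i < k.+1 + m) xi i w.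
Proof.
elim: n k x => [|n IHn] k x /=.
  split=> [x0|[m]]; first by exists 0%N; rewrite // addn0 big_geq.
  by rewrite leqn0 => /eqP ->; rewrite addn0 big_geq.
rewrite lt_max; split.
  case/orP => [x0|]; first by exists 0%N; rewrite // addn0 big_geq.
  rewrite -ltrBlDl => /IHn[m mn xm]; exists m.+1 => //.
  by rewrite addnS -addSn big_ltn ?ltrBlDl// in xm *; rewrite ltn_addr.
case=> -[|m] mn; first by rewrite addn0 big_geq// => ->.
rewrite addnS -addSn big_ltn; last by rewrite addSn ltnS leq_addr.
rewrite -ltrBlDl => xm; apply/orP; right.
by rewrite -ltrBlDl; apply/IHn; exists m.
Qed.

Lemma walk_max_leS n k (w : T) : walk_max n k w <= walk_max n.+1 k w.
Proof.
rewrite leNgt; apply/negP => /walk_max_gtP[m mn xm].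
have := ltxx (walk_max n.+1 k w).
by move/negbT/negP; apply; apply/walk_max_gtP; exists m => //; exact: leqW.
Qed.

Lemma walk_max_ge0 n k (w : T) : 0 <= walk_max n k w.
Proof. by case: n => //= n; rewrite le_max lexx. Qed.

Hypothesis xi_indep : mutually_independent xi.

Let past (J : {fset nat}) (B : nat -> set R) : set T :=
  \bigcap_(i in [set` J]) (xi i @^-1` B i).

Let measurable_past J B : (forall i, measurable (B i)) -> measurable (past J B).
Proof.
by move=> mB; apply: fin_bigcap_measurable => // i _; exact: measurable_funPTI.
Qed.

Let past_next J B k A : (forall i, i \in J -> (i <= k)%N) ->
  (forall i, measurable (B i)) -> measurable A ->
  exists B', [/\ forall i, measurable (B' i),
    past (k.+1 |` J)%fset B' = past J B `&` xi k.+1 @^-1` A &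
    P (past (k.+1 |` J)%fset B') =
      (P (past J B) * distribution P (xi k.+1) A)%E].
Proof.
move=> Jk mB mA; pose B' i := if i == k.+1 then A else B i.
have kJ : k.+1 \notin J by apply/negP => /Jk; rewrite ltnn.
have B'J i : i \in J -> B' i = B i.
  by move=> iJ; rewrite /B' ifN//; apply: contraNneq kJ => <-.
have mB' i : measurable (B' i) by rewrite /B'; case: ifP.
have pastE : past J B' = past J B.
  by apply: eq_bigcapr => i /= iJ; rewrite B'J.
exists B'; split => //.
  by rewrite /past bigcap_fsetU1 setIC -/(past J B') pastE /B' eqxx.
rewrite (xi_indep _ mB') big_fsetU1//= {1}/B' eqxx muleC; congr (_ * _)%E.
rewrite -pastE /past (xi_indep _ mB').
by [].
Qed.

Let max_sum_set (C : set R) : set (R * R) :=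
  [set uv | C (Num.max 0 (uv.1 + uv.2))].

Let measurable_max_sum_set C : measurable C -> measurable (max_sum_set C).
Proof.
move=> mC; rewrite -[max_sum_set C]setTI.
have : measurable_fun setT (fun uv : R * R => Num.max 0 (uv.1 + uv.2)).
  by apply: measurable_maxr => //; exact: measurable_funD.
exact.
Qed.

(** By induction on [n], uniformly in [k]: the increment [xi k.+1] joins the
    past before the induction hypothesis is applied to the walk started at
    [k.+1]. *)
Lemma walk_max_indep_past n k (J : {fset nat}) (B : nat -> set R) (C : set R) :
  (forall i, i \in J -> (i <= k)%N) -> (forall i, measurable (B i)) ->
  measurable C ->
  P (past J B `&` walk_max n k @^-1` C) =
    (P (past J B) * P (walk_max n k @^-1` C))%E.
Proof.
elim: n k J B C => [|n IHn] k J B C Jk mB mC.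
  have [C0|C0] := pselect (C 0).
    rewrite (_ : walk_max 0 k @^-1` C = setT) ?setIT ?probability_setT ?mule1//.
    by apply/seteqP; split.
  rewrite (_ : walk_max 0 k @^-1` C = set0) ?setI0 ?measure0 ?mule0//.
  by apply/seteqP; split.
have joint J' B' : (forall i, i \in J' -> (i <= k)%N) ->
    (forall i, measurable (B' i)) ->
    P (past J' B' `&` walk_max n.+1 k @^-1` C) = (P (past J' B') *
      (distribution P (xi k.+1) \x distribution P (walk_max n k.+1))
        (max_sum_set C))%E.
  move=> J'k mB'.
  apply: (joint_law_of_rectangles (V := walk_max n k.+1)).
  - exact: measurable_past.
  - move=> A A' mA mA'; rewrite setIA.
    have [B2 [mB2 <- PB2]] := past_next J'k mB' mA.
    rewrite IHn//; first by rewrite PB2 muleA.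
    by move=> i; rewrite in_fset1U => /predU1P[->//|/J'k/leqW].
  - exact: measurable_max_sum_set.
rewrite joint//; congr (_ * _)%E.
have := joint fset0 B (fun i => _) mB.
rewrite /past set_fset0 bigcap_set0 setTI probability_setT mul1e => -> //.
Qed.

Lemma walk_maxS_law n k (C : set R) : measurable C ->
  P (walk_max n.+1 k @^-1` C) = (distribution P (xi k.+1) \x
    distribution P (walk_max n k.+1))%E (max_sum_set C).
Proof.
move=> mC; have := @joint_law_of_rectangles _ _ _ P setT (xi k.+1)
  (walk_max n k.+1) (max_sum_set C).
rewrite setTI probability_setT mul1e; apply => //; last exact: measurable_max_sum_set.
move=> A B mA mB; rewrite setTI mul1e.
have [B' [mB' past1 P1]] := @past_next fset0 (fun=> setT) k A
  (fun i => ltac:(done)) (fun=> measurableT) mA.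
have past0 : past fset0 (fun=> setT) = setT by rewrite /past set_fset0 bigcap_set0.
rewrite past0 setTI in past1; rewrite past0 probability_setT mul1e in P1.
rewrite -past1 walk_max_indep_past ?P1//.
by move=> i; rewrite in_fset1U => /predU1P[->|].
Qed.

Variable F : R -> R.
Hypothesis xi_cdf : forall n x, cdf (xi n) x = (F x)%:E.

Lemma walk_max_law n k l (C : set R) : measurable C ->
  P (walk_max n k @^-1` C) = P (walk_max n l @^-1` C).
Proof.
elim: n k l C => [//|n IHn] k l C mC; rewrite !walk_maxS_law//.
have mD := measurable_max_sum_set mC.
transitivity (\int[distribution P (xi k.+1)]_u
    (distribution P (walk_max n l.+1) (xsection (max_sum_set C) u)))%E.
  by apply: eq_integral => u _; apply: IHn; exact: measurable_xsection.
apply: eq_measure_integral => A mA _.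
by apply: eq_cdf_distribution => // x; rewrite !xi_cdf.
Qed.

Local Notation Mx n := (walk_max n 0 : {RV P >-> R}).

(** Conditioning on the first increment. The remaining walk is one index later,
    and [xi 0] replaces [xi 1]; only the laws matter. *)
Lemma ccdf_walk_maxS n (x : R) : 0 <= x ->
  (ccdf (Mx n.+1) x =
   \int[P]_w ccdf (Mx n) (x - xi 0%N w)%R)%E.
Proof.
move=> x0; rewrite {1}/ccdf /distribution /pushforward walk_maxS_law//.
have mccdf : measurable_fun setT (fun u : R => ccdf (Mx n) (x - u)).
  apply: measurableT_comp; first exact: ccdf_measurable.
  exact: measurable_funB.
transitivity (\int[distribution P (xi 1%N)]_u ccdf (Mx n) (x - u)%R)%E.
  apply: eq_integral => u _.
  have xsectionE : xsection (max_sum_set `]x, +oo[) u = `]x - u, +oo[%classic.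
    apply/seteqP; split => v;
      rewrite /xsection/= in_setE /max_sum_set/= !in_itv/= !andbT lt_max.
      by move=> /orP[|]; lra.
    by move=> xuv; apply/orP; right; lra.
  transitivity
    (distribution P (walk_max n 1) (xsection (max_sum_set `]x, +oo[) u)).
    by [].
  by rewrite xsectionE; exact: walk_max_law.
transitivity (\int[distribution P (xi 0%N)]_u ccdf (Mx n) (x - u)%R)%E.
  apply: eq_measure_integral => A mA _.
  by apply: eq_cdf_distribution => // y; rewrite !xi_cdf.
by rewrite ge0_integral_distribution.
Qed.

Lemma walk_sup_gt_bigcup (x : R) :
  [set w | (x%:E < walk_sup xi w)%E] = \bigcup_n (walk_max n 0 @^-1` `]x, +oo[).
Proof.
apply/seteqP; split => w /=.
  move=> /ereal_sup_gt[_ [m _ <-]]; rewrite lte_fin => xm.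
  exists m => //=; rewrite in_itv/= andbT; apply/walk_max_gtP.
  by exists m; rewrite // add1n.
move=> [n _]/=; rewrite in_itv/= andbT => /walk_max_gtP[m _].
rewrite add1n -lte_fin => /lt_le_trans; apply.
by apply: ereal_sup_ubound; exists m.
Qed.

Definition walk_max_tail (n : nat) (x : R) : R := fine (ccdf (Mx n) x).

Lemma cvg_walk_max_tail (x : R) :
  walk_max_tail n x @[n --> \oo] --> walk_sup_tail xi x.
Proof.
have mW n : measurable (walk_max n 0 @^-1` `]x, +oo[).
  exact: measurable_funPTI.
rewrite /walk_sup_tail walk_sup_gt_bigcup; apply: fine_cvg.
rewrite fineK ?fin_num_measure//; last exact: bigcupT_measurable.
apply: (nondecreasing_cvg_mu (F := fun n => walk_max n 0 @^-1` `]x, +oo[)) => //.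
  exact: bigcupT_measurable.
apply/nondecreasing_seqP => n; apply/subsetPset => w /=.
by rewrite !in_itv/= !andbT => /lt_le_trans; apply; exact: walk_max_leS.
Qed.

End walk_maximum.

(** * The supremum of the walk *)

Section supremum.
Context d (T : measurableType d) (R : realType) (P : probability T R).
Variables (xi : nat -> {RV P >-> R}) (F : R -> R) (a : R).
Hypothesis xi_indep : mutually_independent xi.
Hypothesis xi_cdf : forall n x, cdf (xi n) x = (F x)%:E.
Hypothesis X_int : P.-integrable [set: T] (EFin \o xi 0%N).
Hypothesis X_mean : \int[P]_w xi 0%N w = - a.
Hypothesis a_gt0 : 0 < a.
Local Notation X := (xi 0%N).
Local Notation Fs := (integrated_tail F).
Local Notation g := (walk_max_tail xi).
Local Notation h := (walk_sup_tail xi).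

Let g_EFin n x : (g n x)%:E = ccdf (walk_max xi n 0 : {RV P >-> R}) x.
Proof. by rewrite /walk_max_tail fineK// fin_num_measure. Qed.

Let g_nonincr n : nonincreasing_fun (g n).
Proof. by move=> x y xy; rewrite -lee_fin !g_EFin ccdf_nonincreasing. Qed.

Let g01 n x : 0 <= g n x <= 1.
Proof. by rewrite -!lee_fin g_EFin measure_ge0 probability_le1. Qed.

Let g_neg n (x : R) : x < 0 -> g n x = 1.
Proof.
move=> x0; apply: EFin_inj; rewrite g_EFin -(probability_setT P).
congr (P _); apply/seteqP; split => // w _ /=.
by rewrite in_itv/= andbT (lt_le_trans x0)// walk_max_ge0.
Qed.

Let g_leS n x : g n x <= g n.+1 x.
Proof.
rewrite -lee_fin !g_EFin /ccdf /distribution /pushforward.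
apply: le_measure; rewrite ?inE.
- exact: measurable_funPTI.
- exact: measurable_funPTI.
- move=> w /=; rewrite !in_itv/= !andbT => /lt_le_trans; apply.
  exact: walk_max_leS.
Qed.

Let gS n (x : R) : 0 <= x -> g n.+1 x = \int[P]_w g n (x - X w).
Proof.
move=> x0; rewrite /walk_max_tail (ccdf_walk_maxS xi_indep xi_cdf)//.
by congr fine; apply: eq_integral => w _; rewrite g_EFin.
Qed.

(** By [gS] and [g_leS] the drift of [g n] is nonincreasing, and it tends to 0
    because a finite maximum is a finite random variable. *)
Lemma walk_max_tail_submean n : submean_tail X (g n).
Proof.
have g0 : g n x @[x --> +oo] --> (0 : R).
  by apply: fine_cvg; exact: cvg_ccdfy0.
split; [exact: g_nonincr|exact: g01|exact: g_neg|move=> x x0].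
have := cvg_drift X_int (@g_nonincr n) (g01 n) g0; rewrite mul0r.
move=> /cvgr_to_le; apply; near=> m.
apply: (drift_nonincreasing X_int (@g_nonincr n) (g01 n)) => //.
  by near: m; exact: nbhs_infty_ger.
by move=> z z0; rewrite -gS// g_leS.
Unshelve. all: by end_near. Qed.

Let gh x : g n x @[n --> \oo] --> h x.
Proof. exact: cvg_walk_max_tail. Qed.

Lemma walk_max_tail_le_sup n x : g n x <= h x.
Proof.
have := nondecreasing_cvgn_le _ (cvgP _ (@gh x)) n.
rewrite (cvg_lim _ (@gh x))//; apply.
by apply/nondecreasing_seqP => m; exact: g_leS.
Qed.

Lemma walk_sup_tail_le (x c : R) : (forall n, g n x <= c) -> h x <= c.
Proof. by move=> gc; apply: (cvgr_to_le (@gh x)); exact: nearW. Qed.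

Lemma walk_sup_tail_nonincreasing : nonincreasing_fun h.
Proof.
move=> x y xy; apply: (ler_cvg_to (@gh y) (@gh x)).
by apply: nearW => n; exact: g_nonincr.
Qed.

Lemma walk_sup_tail01 x : 0 <= h x <= 1.
Proof.
apply/andP; split.
  by apply: (cvgr_to_ge (@gh x)); apply: nearW => n; have /andP[] := g01 n x.
by apply: (cvgr_to_le (@gh x)); apply: nearW => n; have /andP[] := g01 n x.
Qed.

Lemma walk_sup_tail_neg (x : R) : x < 0 -> h x = 1.
Proof.
move=> x0; apply/eqP; rewrite eq_le; have /andP[_ ->]/= := walk_sup_tail01 x.
by rewrite -(g_neg 0 x0) walk_max_tail_le_sup.
Qed.

(** With [g n] in place of [h] the integral is [g n.+1 x <= h x]; then [n] tends
    to infinity. *)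
Lemma walk_sup_tail_supermean (x : R) : 0 <= x -> \int[P]_w h (x - X w) <= h x.
Proof.
move=> x0.
have mg (f : R -> R) : nonincreasing_fun f ->
    measurable_fun setT (fun w => (f (x - X w))%:E).
  move=> f_ni; apply/measurable_EFinP; apply: measurable_comp_reflect.
  exact: nonincreasing_measurable.
have [] := @dominated_convergence _ _ _ P setT measurableT
  (fun n w => (g n (x - X w))%:E) (fun w => (h (x - X w))%:E) (cst 1%:E).
- by move=> n; exact/mg/g_nonincr.
- exact/mg/walk_sup_tail_nonincreasing.
- apply: nearW => w _; apply: cvg_EFin; first exact: nearW.
  exact: gh.
- exact: (finite_measure_integrable_cst P 1 measurableT).
- apply: nearW => w n _; rewrite lee_fin.
  by have /andP[g0 g1] := g01 n (x - X w); rewrite ger0_norm.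
move=> i_h _ lim; have {}lim : \int[P]_w g n (x - X w) @[n --> \oo] -->
    \int[P]_w h (x - X w).
  apply: fine_cvg; rewrite fineK//; exact: (integrable_fin_num measurableT i_h).
apply: (cvgr_to_le lim); apply: nearW => n.
by rewrite -gS// walk_max_tail_le_sup.
Qed.

(** The drift is nondecreasing with limit [- a * p <= 0], where [p] is the limit
    of [h], that is the probability that the supremum is infinite. *)
Lemma walk_sup_drift_le0 (x : R) : 0 <= x -> drift X h x <= 0.
Proof.
move=> x0; pose nh := \- h.
have nh_cvg : nh r @[r --> +oo] --> sup (range nh).
  apply: nondecreasing_cvgr.
    by move=> u v uv; rewrite lerN2 walk_sup_tail_nonincreasing.
  exists 0 => _ [u _ <-]; rewrite oppr_le0.
  by have /andP[] := walk_sup_tail01 u.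
pose p := - sup (range nh).
have hp : h r @[r --> +oo] --> p.
  have -> : h = \- nh by apply/funext => u; rewrite /nh /= opprK.
  exact: cvgN nh_cvg.
have p0 : 0 <= p.
  by apply: (cvgr_to_ge hp); apply: nearW => u; have /andP[] := walk_sup_tail01 u.
have := cvg_drift X_int walk_sup_tail_nonincreasing walk_sup_tail01 hp.
rewrite X_mean => lim.
apply: (@le_trans _ _ (p * - a)); last by rewrite mulrN oppr_le0 mulr_ge0// ltW.
apply: (cvgr_to_ge lim); near=> m.
apply: (drift_nondecreasing X_int walk_sup_tail_nonincreasing walk_sup_tail01) => //.
  by near: m; exact: nbhs_infty_ger.
exact: walk_sup_tail_supermean.
Unshelve. all: by end_near. Qed.

Lemma walk_sup_tail_lower (x : R) : 0 <= x -> Fs x <= h x * (a + Fs x).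
Proof.
move=> x0; have := le_trans
  (drift_lower_bound (xi_cdf 0) X_int walk_sup_tail_nonincreasing walk_sup_tail01
     walk_sup_tail_neg x0) (walk_sup_drift_le0 x0).
by rewrite X_mean; move: (h x) (Fs x) => u v; lra.
Qed.

Lemma walk_sup_tail_ratio_lower (e : R) : 0 < e -> (forall x, 0 < tail F x) ->
  \forall x \near +oo, (a + e)^-1 <= h x / Fs x.
Proof.
move=> e0 tail0; have Fs0 := integrated_tail_gt0 (xi_cdf 0) X_int tail0.
near=> x.
have x0 : 0 <= x by near: x; exact: nbhs_pinfty_ge.
have Fse : Fs x <= e.
  near: x; have /cvgrPdist_le/(_ _ e0) := integrated_tail_cvg0 (xi_cdf 0) X_int.
  by apply: filterS => x; rewrite sub0r normrN ger0_norm// ltW.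
have ae0 : 0 < a + e by rewrite addr_gt0.
rewrite ler_pdivlMr// mulrC ler_pdivrMr//.
apply: (le_trans (walk_sup_tail_lower x0)); apply: ler_wpM2l.
  by have /andP[] := walk_sup_tail01 x.
by rewrite lerD2l.
Unshelve. all: by end_near. Qed.

(** If the tail vanishes at [x], then [X <= x] almost surely and the moment
    generating function at 1 is at most [expR x]. *)
Lemma long_tailed_tail_gt0 (x : R) : long_tailed X -> 0 < tail F x.
Proof.
move=> /(_ 1 ltr01) mgf; rewrite lt_neqAle (tail_ge0 (xi_cdf 0)) andbT.
apply/eqP => tx; have : (mmt_gen_fun P X 1 <= (expR x)%:E)%E; last by rewrite mgf.
have le_x : {ae P, forall w, X w <= x}.
  exists (X @^-1` `]x, +oo[); split; first exact: measurable_funPTI.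
    by have := ccdf_tail (xi_cdf 0) x; rewrite -tx.
  by move=> w /= /negP; rewrite -ltNge in_itv/= andbT.
have m_exp : measurable_fun setT (fun w => (expR (X w * 1))%:E).
  apply/measurable_EFinP; apply: measurableT_comp => //.
  exact: measurable_funM.
rewrite /mmt_gen_fun expectation_def.
apply: (@le_trans _ _ (\int[P]_w (expR x)%:E)%E).
  apply: ae_ge0_le_integral => //.
  - by move=> w _; rewrite lee_fin expR_ge0.
  - by apply: filterS le_x => w wx _; rewrite lee_fin /= ler_expR mulr1.
by rewrite integral_cst//= probability_setT mule1.
Qed.

End supremum.

Lemma invr_le_perturbed (R : realFieldType) (a e : R) : 0 < a -> 0 < e ->
  a^-1 <= (a + e * (a * a))^-1 + e.
Proof.
move=> a0 e0; have ea : 0 < e * a by exact: mulr_gt0.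
have ea1 : 0 < 1 + e * a by lra.
have -> : (a + e * (a * a))^-1 = (1 + e * a)^-1 / a.
  by field; rewrite (gt_eqF a0) gt_eqF//; nra.
rewrite -(ler_pM2r a0) mulVf ?gt_eqF// mulrDl divfK ?gt_eqF//.
rewrite -lerBlDr -[_^-1]mul1r ler_pdivlMr//.
have : 0 <= (e * a) * (e * a) by rewrite mulr_ge0// ltW.
by move: (e * a) => t; lra.
Qed.

Lemma ratio_close (R : realFieldType) (a e u v : R) : 0 < a -> 0 < e -> 0 < v ->
  (a + a * e)^-1 <= u / v -> u <= (1 + e) / a * v ->
  `|1 - u / (a^-1 * v)| <= e.
Proof.
move=> a0 e0 v0 lo up; have ae0 : a != 0 by rewrite gt_eqF.
have -> : u / (a^-1 * v) = a * (u / v) by field; rewrite ae0 gt_eqF.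
rewrite -ler_pdivrMr// in up.
rewrite distrC ler_distl; apply/andP; split.
  have : a * (a + a * e)^-1 <= a * (u / v) by rewrite ler_pM2l.
  apply: le_trans; have -> : a * (a + a * e)^-1 = (1 + e)^-1.
    by rewrite (_ : a + a * e = a * (1 + e)) ?invfM ?mulVKf//; ring.
  rewrite -[_^-1]mul1r ler_pdivlMr; last lra.
  by have : 0 <= e * e by [rewrite mulr_ge0// ltW]; lra.
have : a * (u / v) <= a * ((1 + e) / a) by rewrite ler_pM2l.
by rewrite [a * (_ / a)]mulrC divfK.
Qed.

(* [xi 0] is the generic variable; the walk has increments [xi 1, xi 2, ...]. *)
Theorem corollary4 (d : measure_display) (T : measurableType d) (R : realType)
    (P : probability T R) (xi : nat -> {RV P >-> R}) (F : R -> R) (a : R)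
    (xi_indep : mutually_independent xi)
    (xi_cdf : forall (n : nat) (x : R), cdf (xi n) x = (F x)%:E)
    (xi_integrable : P.-integrable [set: T] (EFin \o xi 0%N))
    (xi_mean : ('E_P[xi 0%N] = (- a)%:E)%E)
    (a_gt0 : 0 < a) :
  (long_tailed (xi 0%N) ->
     ((a^-1)%:E <=
        limf_einf (fun x : R => (walk_sup_tail xi x / integrated_tail F x)%:E)
                  (pinfty_nbhs R))%E)
  /\
  (strong_subexponential F ->
     asymp_equiv (walk_sup_tail xi) (fun x : R => a^-1 * integrated_tail F x)).
Proof.
have X_mean : \int[P]_w xi 0%N w = - a.
  by rewrite /Rintegral -expectation_def xi_mean.
have Xcdf := xi_cdf 0%N.
split=> [heavy|F_strong].
  have tail0 x : 0 < tail F x by exact: (long_tailed_tail_gt0 xi_cdf).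
  apply/lee_addgt0Pr => e e0.
  have de0 : 0 < e * (a * a) by rewrite !mulr_gt0.
  have lower := walk_sup_tail_ratio_lower xi_indep xi_cdf xi_integrable X_mean
    a_gt0 de0 tail0.
  rewrite limf_einfE.
  (* 1/a - 1/(a + t) <= t / a^2, here with t = e a^2 *)
  apply: (@le_trans _ _ (((a + e * (a * a))^-1)%:E + e%:E)%E).
    by rewrite -EFinD lee_fin; exact: invr_le_perturbed.
  rewrite leeD2r//; apply: (@le_trans _ _ (ereal_inf
    ((fun x => (walk_sup_tail xi x / integrated_tail F x)%:E) @`
       [set x | (a + e * (a * a))^-1 <=
                walk_sup_tail xi x / integrated_tail F x]))).
    by apply: le_ereal_inf_tmp => _ [x hx <-]; rewrite lee_fin.
  by apply: ereal_sup_ubound; eexists; first exact: lower.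
have tail0 := strong_subexponential_tail_gt0 Xcdf xi_integrable F_strong.
have Fs0 := integrated_tail_gt0 Xcdf xi_integrable tail0.
apply/cvgrPdist_le => e e0.
have lower := walk_sup_tail_ratio_lower xi_indep xi_cdf xi_integrable X_mean a_gt0
  (mulr_gt0 a_gt0 e0) tail0.
have upper := submean_tail_limsup Xcdf xi_integrable X_mean a_gt0 F_strong e0.
near=> x.
have h_lo : (a + a * e)^-1 <= walk_sup_tail xi x / integrated_tail F x.
  by near: x; exact: lower.
have h_up : walk_sup_tail xi x <= (1 + e) / a * integrated_tail F x.
  have up h : submean_tail (xi 0%N) h -> h x <= (1 + e) / a * integrated_tail F x.
    by move: h; near: x; exact: upper.
  apply: walk_sup_tail_le => n; apply: up.
  exact: (walk_max_tail_submean xi_indep xi_cdf xi_integrable).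
exact: (ratio_close a_gt0 e0 (Fs0 x) h_lo h_up).
Unshelve. all: by end_near. Qed.
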